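(* Let $F$ be a field that is either algebraically closed with $\mathrm{char}(F)\neq 2$ or real closed. Let $X$ be an indeterminate over $F$, $D_n=F[X^{\frac{1}{2^n}},X^{-\frac{1}{2^n}}]$ for each $n\in\mathbb{N}_0$ and $D=\bigcup_{n\in\mathbb{N}_0}D_n$. Then: (1) $D$ is an SP domain that is not Dedekind. (2) $D$ has no irreducible element. (3) Each maximal ideal of $D$ is not invertible. (4) Each nonzero nonunit of $D$ is contained in $2^{\aleph_0}$ maximal ideals of $D$. (5) $\mathrm{ht}(M[[Y]]/MD[[Y]])\ge 2^{\aleph_1}$ for all maximal ideals $M$ of $D$, where $Y$ is an indeterminate over $D$. Hence $\dim(D[[Y]])\ge 2^{\aleph_1}$, and equality holds under the continuum hypothesis if $F$ is countable.
   Context: $\mathbb{N}_0$ is the set of nonnegative integers. The elements $X^{1/2^n}$ are compatible roots of $X$, i.e. $(X^{1/2^{n+1}})^2=X^{1/2^n}$, so $D_n\subsetneq D_{n+1}$. A field $F$ is real closed if $1<[\overline{F}:F]<\infty$, where $\overline{F}$ is an algebraic closure of $F$. An SP domain is an integral domain in which each proper ideal can be written as a finite product of radical ideals. $D[[Y]]$ is the power series ring over $D$; for an ideal $I$ of $D$, $I[[Y]]=\{\sum_{i\ge0}a_iY^i\mid a_i\in I\text{ for all }i\}$, which contains $ID[[Y]]$ and is prime in $D[[Y]]$ when $I$ is prime; $M[[Y]]/MD[[Y]]$ is regarded as a prime ideal of $D[[Y]]/MD[[Y]]$. The length of a chain $\mathcal{C}$ of prime ideals (a nonempty totally ordered set of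 primes) is $|\mathcal{C}|-1$. The Krull dimension $\dim A$ is the largest cardinal $\alpha$ (if any) such that there is a chain of prime ideals of $A$ of length $\alpha$; $\dim A\ge\alpha$ means that there is a chain of prime ideals of $A$ of length $\ge\alpha$; $\mathrm{ht}P=\dim A_P$ for a prime ideal $P$ of $A$. *)

(* Defs.v *)
From HB Require Import structures.
From mathcomp Require Import all_boot all_order all_algebra all_field.
From mathcomp Require Import ring_quotient generic_quotient fraction.
From mathcomp Require Import all_classical ring.

Set Implicit Arguments.
Unset Strict Implicit.
Unset Printing Implicit Defensive.

Import GRing.Theory.
Local Open Scope ring_scope.
Local Open Scope classical_set_scope.
Local Open Scope card_scope.
Local Open Scope quotient_scope.

(* A cardinal is represented by a type.  [aleph1] is the set of order types
   (classes of order-isomorphic relations) of the well-orderings of nat, that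
   is, the set of countably infinite ordinals (Cantor's second number class). *)
Definition similar (r s : nat -> nat -> bool) : Prop :=
  exists2 f : nat -> nat, bijective f & {mono f : x y / r x y >-> s x y}.

Definition order_type (r : nat -> nat -> bool) :
    set (nat -> nat -> bool) := [set s | similar r s].

Definition aleph1 : Type :=
  set_type [set order_type r | r in
    [set r : nat -> nat -> bool | wochoice.well_order r]].

Definition continuum_hypothesis : Prop := [set: set nat] #= [set: aleph1].

Definition algebraic_closure (F : fieldType) (K : fieldExtType F) : Prop :=
  GRing.closed_field_axiom K /\ forall z : K, algebraicOver (in_alg K) z.

(* [fieldExtType F] only contains the finite extensions of F. *)
Definition real_closed (F : fieldType) : Prop :=
  exists K : fieldExtType F, algebraic_closure K /\ (1 < \dim {:K})%N.

Section Ideals.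
Variable R : comNzRingType.
Implicit Types I J P M : set R.

Definition ideal I : Prop :=
  [/\ I 0, forall x y, I x -> I y -> I (x + y) & forall a x, I x -> I (a * x)].

Definition proper_ideal I : Prop := ideal I /\ ~ I 1.

Definition prime_ideal P : Prop :=
  proper_ideal P /\ forall x y, P (x * y) -> P x \/ P y.

Definition maximal_ideal M : Prop :=
  proper_ideal M /\ forall J, proper_ideal J -> M `<=` J -> J = M.

Definition radical_ideal I : Prop :=
  ideal I /\ forall x n, I (x ^+ n) -> I x.

Definition ideal_mul I J : set R :=
  smallest ideal [set x * y | x in I & y in J].

Definition finite_product_of (C : set R -> Prop) I : Prop :=
  exists (n : nat) (J : 'I_n -> set R),
    (forall i, C (J i)) /\ I = \big[ideal_mul/setT]_(i < n) J i.

Lemma idealN I x : ideal I -> I x -> I (- x).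
Proof. by case=> _ _ IM Ix; rewrite -mulN1r; apply: IM. Qed.

Lemma idealB I x y : ideal I -> I x -> I y -> I (x - y).
Proof. by move=> II Ix Iy; case: (II) => _ ID _; apply: ID => //; exact: idealN. Qed.

Lemma ideal_smallest (S : set R) : ideal (smallest ideal S).
Proof.
split.
- by move=> I [[I0 _ _] _].
- by move=> x y Sx Sy I SI; have [[_ ID _] _] := SI; exact: ID (Sx I SI) (Sy I SI).
- by move=> a x Sx I SI; have [[_ _ IM] _] := SI; exact: IM (Sx I SI).
Qed.

Lemma maximal_prime M : maximal_ideal M -> prime_ideal M.
Proof.
move=> [[MI M1] Mmax]; split=> // x y Mxy.
have [Mx|nMx] := pselect (M x); [by left | right].
have [M0 MD MM] := MI.
pose J : set R := [set z | exists m a, M m /\ z = m + a * x].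
have JI : ideal J.
  split; first by exists 0, 0; rewrite mul0r addr0.
    move=> _ _ [m [a [Mm ->]]] [m' [a' [Mm' ->]]]; exists (m + m'), (a + a').
    by rewrite mulrDl addrACA; split=> //; apply: MD.
  move=> b _ [m [a [Mm ->]]]; exists (b * m), (b * a).
  by rewrite mulrDr mulrA; split=> //; apply: MM.
have MJ : M `<=` J by move=> m Mm; exists m, 0; rewrite mul0r addr0.
have [[m [a [Mm e]]]|nJ1] := pselect (J 1).
  rewrite -[y]mul1r e mulrDl; apply: MD; first by rewrite mulrC; apply: MM.
  by rewrite -mulrA; apply: MM.
case: nMx; rewrite -(Mmax J) //; exists 0, 1.
by rewrite mul1r add0r.
Qed.

(* [ideal_pred] turns a proper ideal into an instance of the library's [idealr],
   which is what [{ideal_quot _}] takes. *)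
Definition ideal_pred I (hI : proper_ideal I) : {pred R} := fun x => `[< I x >].

Lemma ideal_pred_closed I (hI : proper_ideal I) : idealr_closed (ideal_pred hI).
Proof.
have [[I0 ID IM] I1] := hI; split.
- exact/asboolP.
- exact/asboolPn.
- by move=> a x y /asboolP Ix /asboolP Iy; apply/asboolP/ID => //; apply: IM.
Qed.

HB.instance Definition _ I (hI : proper_ideal I) :=
  isIdealr.Build R (ideal_pred hI) (ideal_pred_closed hI).

End Ideals.

Notation ideal_quotient hI := {ideal_quot (ideal_pred hI)}.

Section Localization.
Variables (R : comNzRingType) (P : set R) (hP : prime_ideal P).

Definition denominator := {s : R | ~~ `[< P s >]}.

(* Fractions carry the proof that P is prime as a phantom parameter, so that the
   equivalence instance on them can be inferred. *)
Definition loc_frac & prime_ideal P : Type := (R * denominator)%type.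
HB.instance Definition _ := Choice.copy (loc_frac hP) (R * denominator)%type.

Local Notation frac := (loc_frac hP).
Implicit Types x y z : frac.
Local Notation den x := (sval x.2).

Definition loc_equiv x y : bool :=
  `[< exists2 u, ~ P u & u * (x.1 * den y) = u * (y.1 * den x) >].

Lemma denP (s : denominator) : ~ P (sval s).
Proof. by move: (valP s) => /asboolP. Qed.

Lemma nonprimeM u v : ~ P u -> ~ P v -> ~ P (u * v).
Proof. by move=> nu nv /(hP.2)[]. Qed.

Lemma nonprime1 : ~ P 1. Proof. exact: hP.1.2. Qed.

Lemma loc_equiv_is_equiv : equiv_class_of loc_equiv.
Proof.
split=> [x|x y|y x z].
- by apply/asboolP; exists 1; first exact: nonprime1.
- by apply/asboolP/asboolP => -[u nu e]; exists u.
move=> /asboolP[u nu exy] /asboolP[v nv eyz]; apply/asboolP.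
exists (u * v * den y).
  by apply: nonprimeM; [exact: nonprimeM | exact: denP].
transitivity (v * den z * (u * (x.1 * den y))); first by ring.
rewrite exy; transitivity (u * den x * (v * (y.1 * den z))); first by ring.
by rewrite eyz; ring.
Qed.

Canonical loc_equiv_equiv := EquivRelPack loc_equiv_is_equiv.
Canonical loc_equiv_encModRel := defaultEncModRel loc_equiv.

Definition localization := {eq_quot loc_equiv}.
HB.instance Definition _ : EqQuotient _ loc_equiv localization :=
  EqQuotient.on localization.
HB.instance Definition _ := Choice.on localization.

Lemma den1_subproof : ~~ `[< P 1 >].
Proof. by apply/asboolP/nonprime1. Qed.

Lemma denM_subproof (s t : denominator) : ~~ `[< P (sval s * sval t) >].
Proof. by apply/asboolP/nonprimeM; apply: denP. Qed.

Definition den1 : denominator := exist _ 1 den1_subproof.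
Definition denM s t : denominator := exist _ (sval s * sval t) (denM_subproof s t).

Definition frac_of (a : R) : frac := (a, den1).
Definition addl x y : frac :=
  (x.1 * den y + y.1 * den x, denM x.2 y.2).
Definition oppl x : frac := (- x.1, x.2).
Definition mull x y : frac := (x.1 * y.1, denM x.2 y.2).

Definition loc_zero := lift_cst localization (frac_of 0).
Definition loc_one := lift_cst localization (frac_of 1).
Definition loc_add := lift_op2 localization addl.
Definition loc_opp := lift_op1 localization oppl.
Definition loc_mul := lift_op2 localization mull.

Canonical pi_loc_zero_morph := PiConst loc_zero.
Canonical pi_loc_one_morph := PiConst loc_one.

Lemma loc_eqP x y :
  reflect (exists2 u, ~ P u & u * (x.1 * den y) = u * (y.1 * den x))
          (x == y %[mod localization]).
Proof. by rewrite piE; apply: asboolP. Qed.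

Lemma loc_reprP x : exists2 u, ~ P u &
  u * (x.1 * den (repr (\pi_localization x))) =
  u * ((repr (\pi_localization x)).1 * den x).
Proof. by apply/loc_eqP; rewrite reprK. Qed.

Lemma pi_loc_opp : {morph \pi : x / oppl x >-> loc_opp x}.
Proof.
move=> x; unlock loc_opp; apply/eqP/loc_eqP => /=.
by have [u nu e] := loc_reprP x; exists u => //; rewrite !mulNr !mulrN e.
Qed.
Canonical pi_loc_opp_morph := PiMorph1 pi_loc_opp.

Lemma pi_loc_add : {morph \pi : x y / addl x y >-> loc_add x y}.
Proof.
move=> x y; unlock loc_add; apply/eqP/loc_eqP => /=.
have [u nu ex] := loc_reprP x; have [v nv ey] := loc_reprP y.
move: (repr (\pi x)) ex (repr (\pi y)) ey => x' ex y' ey.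
exists (u * v); first exact: nonprimeM.
transitivity (v * (den y * den y') * (u * (x.1 * den x')) +
              u * (den x * den x') * (v * (y.1 * den y'))); first by ring.
by rewrite ex ey; ring.
Qed.
Canonical pi_loc_add_morph := PiMorph2 pi_loc_add.

Lemma pi_loc_mul : {morph \pi : x y / mull x y >-> loc_mul x y}.
Proof.
move=> x y; unlock loc_mul; apply/eqP/loc_eqP => /=.
have [u nu ex] := loc_reprP x; have [v nv ey] := loc_reprP y.
move: (repr (\pi x)) ex (repr (\pi y)) ey => x' ex y' ey.
exists (u * v); first exact: nonprimeM.
transitivity ((u * (x.1 * den x')) * (v * (y.1 * den y'))); first by ring.
by rewrite ex ey; ring.
Qed.
Canonical pi_loc_mul_morph := PiMorph2 pi_loc_mul.

Lemma loc_eq x y : x.1 * den y = y.1 * den x -> x = y %[mod localization].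
Proof.
by move=> e; apply/eqP/loc_eqP; exists 1; [exact: nonprime1 | rewrite e].
Qed.

Lemma loc_addA : associative loc_add.
Proof.
elim/quotW=> x; elim/quotW=> y; elim/quotW=> z; rewrite !piE.
by apply: loc_eq => /=; ring.
Qed.

Lemma loc_addC : commutative loc_add.
Proof.
by elim/quotW=> x; elim/quotW=> y; rewrite !piE; apply: loc_eq => /=; ring.
Qed.

Lemma loc_add0 : left_id loc_zero loc_add.
Proof. by elim/quotW=> x; rewrite !piE; apply: loc_eq => /=; ring. Qed.

Lemma loc_addN : left_inverse loc_zero loc_opp loc_add.
Proof. by elim/quotW=> x; rewrite !piE; apply: loc_eq => /=; ring. Qed.

HB.instance Definition _ :=
  GRing.isZmodule.Build localization loc_addA loc_addC loc_add0 loc_addN.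

Lemma loc_mulA : associative loc_mul.
Proof.
elim/quotW=> x; elim/quotW=> y; elim/quotW=> z; rewrite !piE.
by apply: loc_eq => /=; ring.
Qed.

Lemma loc_mulC : commutative loc_mul.
Proof.
by elim/quotW=> x; elim/quotW=> y; rewrite !piE; apply: loc_eq => /=; ring.
Qed.

Lemma loc_mul1 : left_id loc_one loc_mul.
Proof. by elim/quotW=> x; rewrite !piE; apply: loc_eq => /=; ring. Qed.

Lemma loc_mulDl : left_distributive loc_mul loc_add.
Proof.
elim/quotW=> x; elim/quotW=> y; elim/quotW=> z; rewrite !piE.
by apply: loc_eq => /=; ring.
Qed.

Lemma loc_nonzero1 : loc_one != loc_zero.
Proof.
rewrite !piE; apply/asboolP => -[u nu] /=.
rewrite !mul1r mul0r mulr1 mulr0 => u0; apply: nu; rewrite u0.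
by have [[[]]] := hP.
Qed.

HB.instance Definition _ := GRing.Zmodule_isComNzRing.Build localization
  loc_mulA loc_mulC loc_mul1 loc_mulDl loc_nonzero1.

End Localization.

Section Dimension.
Variable R : comNzRingType.

Definition prime_chain (C : set (set R)) : Prop :=
  [/\ C !=set0, C `<=` @prime_ideal R & total_on C subset].

(* The length of C is |C| - 1, so it is compared to the cardinal T through
   |C| and T + 1 = [option T]. *)
Definition length_ge (C : set (set R)) (T : Type) := [set: option T] #<= C.
Definition length_le (C : set (set R)) (T : Type) := C #<= [set: option T].
Definition length_eq (C : set (set R)) (T : Type) := C #= [set: option T].

Definition dim_ge (T : Type) : Prop :=
  exists2 C, prime_chain C & length_ge C T.

Definition dim_eq (T : Type) : Prop :=
  (exists2 C, prime_chain C & length_eq C T) /\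
  (forall C, prime_chain C -> length_le C T).

End Dimension.

Definition ht_ge (R : comNzRingType) (P : set R) (hP : prime_ideal P) T : Prop :=
  dim_ge (localization hP) T.

Definition powerSeries (R : comNzRingType) : Type := nat -> R.

Section PowerSeries.
Variable R : comNzRingType.
Implicit Types f g h : powerSeries R.

HB.instance Definition _ := GRing.Zmodule.copy (powerSeries R) (nat -> R).

Definition ps_one : powerSeries R := fun n => (n == 0)%:R.
Definition ps_mul f g : powerSeries R :=
  fun n => \sum_(i < n.+1) f i * g (n - i)%N.

Definition ps_trunc n f : {poly R} := \poly_(i < n) f i.

Lemma ps_mulE n k f g : (k < n)%N ->
  ps_mul f g k = (ps_trunc n f * ps_trunc n g)`_k.
Proof.
move=> kn; rewrite coefM; apply: eq_bigr => i _; rewrite !coef_poly.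
rewrite (leq_ltn_trans (leq_subr _ _) kn).
by rewrite (leq_ltn_trans _ kn) // -ltnS.
Qed.

Lemma ps_truncE n k f : (k < n)%N -> (ps_trunc n f)`_k = f k.
Proof. by move=> kn; rewrite coef_poly kn. Qed.

Lemma ps_mulC : commutative ps_mul.
Proof. by move=> f g; apply/funext => k; rewrite !(@ps_mulE k.+1) // mulrC. Qed.

Lemma ps_mulA : associative ps_mul.
Proof.
move=> f g h; apply/funext => k.
pose T := ps_trunc k.+1.
transitivity (T f * (T g * T h))`_k.
  rewrite coefM; apply: eq_bigr => i _.
  by rewrite (@ps_mulE k.+1) ?ltnS ?leq_subr // ps_truncE.
rewrite mulrA coefM; apply: eq_bigr => i _.
by rewrite (@ps_mulE k.+1) // ps_truncE ?ltnS ?leq_subr.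
Qed.

Lemma ps_mul1 : left_id ps_one ps_mul.
Proof.
move=> f; apply/funext => k; rewrite /ps_mul big_ord_recl /= mul1r subn0.
by rewrite big1 ?addr0 // => i _; rewrite /ps_one /= mul0r.
Qed.

Lemma ps_mulDl : left_distributive ps_mul +%R.
Proof.
move=> f g h; apply/funext => k; rewrite /ps_mul -[RHS]big_split /=.
by apply: eq_bigr => i _; rewrite -mulrDl.
Qed.

Lemma ps_nonzero1 : ps_one != 0.
Proof. by apply/eqP => /(congr1 (@^~ 0)) /eqP; rewrite oner_eq0. Qed.

HB.instance Definition _ := GRing.Zmodule_isComNzRing.Build (powerSeries R)
  ps_mulA ps_mulC ps_mul1 ps_mulDl ps_nonzero1.

Definition ps_const (a : R) : powerSeries R := fun n => if n is 0 then a else 0.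

(* I[[Y]] *)
Definition series_ideal (I : set R) : set (powerSeries R) :=
  [set f | forall i, I (f i)].

(* I R[[Y]] *)
Definition extended_ideal (I : set R) : set (powerSeries R) :=
  smallest (@ideal (powerSeries R)) [set ps_const a | a in I].

Lemma ideal_sum I (J : finType) (Q : pred J) (F : J -> R) :
  ideal I -> (forall j, Q j -> I (F j)) -> I (\sum_(j | Q j) F j).
Proof. by case=> I0 ID _ IF; apply: big_ind. Qed.

Lemma series_idealP I : ideal I -> ideal (series_ideal I).
Proof.
move=> II; have [I0 ID IM] := II; split=> [i //|f g If Ig i|f g Ig i].
  exact: ID.
by apply: ideal_sum => // j _; apply: IM.
Qed.

Lemma series_ideal_prime P : prime_ideal P -> prime_ideal (series_ideal P).
Proof.
move=> [[PI P1] Pprime]; split.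
  by split; [exact: series_idealP | move=> /(_ 0%N)].
move=> f g Pfg; apply: contrapT => /not_orP[/existsNP nf /existsNP ng].
have ex_nP (h : powerSeries R) : (exists i, ~ P (h i)) ->
    exists2 i, ~ P (h i) & forall j, (j < i)%N -> P (h j).
  move=> [i ni]; have exi : exists i, ~~ `[< P (h i) >].
    by exists i; apply/asboolP.
  have [m /asboolP nm mmin] := ex_minnP exi; exists m => // j.
  by apply: contraPP => nj; rewrite ltnNge; apply/negP/negPn/mmin/asboolP.
have [m nm mmin] := ex_nP f nf; have [n nn nmin] := ex_nP g ng.
have m_lt : (m < (m + n).+1)%N by rewrite ltnS leq_addr.
have := Pfg (m + n)%N; rewrite /GRing.mul /= /ps_mul (bigD1 (Ordinal m_lt)) //=.
rewrite addKn; set S := \sum_(i | _) _ => PmnS.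
have PS : P S.
  apply: ideal_sum => // i neq_im; have [_ _ PM] := PI.
  have [im|] := ltnP i m; first by rewrite mulrC; apply/PM/mmin.
  rewrite leq_eqVlt eq_sym => /orP[/eqP eim|mi].
    by case/eqP: neq_im; apply: val_inj.
  by apply/PM/nmin; rewrite ltn_subLR ?ltn_add2r // -ltnS.
have : P (f m * g n).
  by have := idealB PI PmnS PS; rewrite addrK.
by case/Pprime.
Qed.

Lemma extended_sub_series I : ideal I -> extended_ideal I `<=` series_ideal I.
Proof.
move=> II; apply: smallest_sub; first exact: series_idealP.
by move=> _ [a Ia <-] [|i] //=; case: II.
Qed.

Lemma extended_ideal_proper P :
  prime_ideal P -> proper_ideal (extended_ideal P).
Proof.
move=> [[PI P1] _]; split; first exact: ideal_smallest.
by move=> /(extended_sub_series PI) /(_ 0%N).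
Qed.

(* P[[Y]] / P R[[Y]] in R[[Y]] / P R[[Y]] *)
Definition series_quot P (hP : prime_ideal P) :
    set (ideal_quotient (extended_ideal_proper hP)) :=
  [set \pi_(ideal_quotient (extended_ideal_proper hP)) f | f in series_ideal P].
Arguments series_quot {P} hP _.

Lemma series_quot_prime P (hP : prime_ideal P) : prime_ideal (series_quot hP).
Proof.
have [[PI P1] _] := hP.
have [[SI S1] Sprime] := series_ideal_prime hP; have [S0 SD SM] := SI.
have piS f : series_quot hP (\pi f) -> series_ideal P f.
  move=> [g Sg /eqP]; rewrite -Quotient.idealrBE => /asboolP Egf.
  rewrite -(subKr g f); exact: (idealB SI Sg (extended_sub_series PI Egf)).
split; last first.
  elim/quotW => f; elim/quotW => g; rewrite -rmorphM => /piS.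
  by case/Sprime => [Sf|Sg]; [left; exists f | right; exists g].
split; last by rewrite -(rmorph1 (\pi_(ideal_quotient (extended_ideal_proper hP)))) => /piS.
split.
- by exists 0; rewrite ?rmorph0.
- by move=> _ _ [f Sf <-] [g Sg <-]; exists (f + g); rewrite ?rmorphD //; apply: SD.
- by elim/quotW => f _ [g Sg <-]; exists (f * g); rewrite ?rmorphM //; apply: SM.
Qed.

End PowerSeries.

Arguments series_quot {R P} hP _.

Section Domains.
Variable R : idomainType.
Local Notation K := {fraction R}.
Local Notation tofrac := (@FracField.tofrac R).
Local Notation "x %:F" := (tofrac x).

Definition SP_domain : Prop :=
  forall I : set R, proper_ideal I -> finite_product_of (@radical_ideal R) I.

Definition Dedekind_domain : Prop :=
  forall I : set R, proper_ideal I -> finite_product_of (@prime_ideal R) I.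

Definition irreducible (p : R) : Prop :=
  [/\ p != 0, p \isn't a GRing.unit & forall a b : R, p = a * b ->
    a \is a GRing.unit \/ b \is a GRing.unit].

Definition submodule (J : set K) : Prop :=
  [/\ J 0, forall x y, J x -> J y -> J (x + y) &
      forall a x, J x -> J (a%:F * x)].

Definition fractional_ideal (J : set K) : Prop :=
  submodule J /\ exists2 d : R, d != 0 & forall x, J x -> range tofrac (d%:F * x).

Definition fractional_mul (I J : set K) : set K :=
  smallest submodule [set x * y | x in I & y in J].

Definition invertible (I : set R) : Prop :=
  exists2 J, fractional_ideal J &
    fractional_mul [set x%:F | x in I] J = range tofrac.

End Domains.

(* An indeterminate X over F with a compatible system of roots
   X n = X^(1/2^n), in some field extension L of F. *)
Record dyadic_roots (F L : fieldType) (iota : {rmorphism F -> L}) := DyadicRoots {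
  dyadic_root :> nat -> L;
  dyadic_root_sqr : forall n, dyadic_root n.+1 ^+ 2 = dyadic_root n;
  dyadic_root_transcendental : ~ algebraicOver iota (dyadic_root 0)
}.

Section DyadicLaurent.
Variables (F L : fieldType) (iota : {rmorphism F -> L}).
Variable X : dyadic_roots iota.

(* D_n = F[X^(1/2^n), X^(-1/2^n)] as a subring of L *)
Definition laurent (n : nat) : set L :=
  smallest (fun S : set L => GRing.subring_closed [in S])
    (range iota `|` [set X n; (X n)^-1]).

Definition dyadic_laurent : {pred L} :=
  fun z => `[< (\bigcup_n laurent n) z >].

Lemma laurent_subring n : GRing.subring_closed [in laurent n].
Proof.
split.
- by apply/mem_set => S [[S1 _ _] _]; apply/set_mem.
- move=> x y /set_mem Lx /set_mem Ly; apply/mem_set => S hS.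
  have [[_ SB _] _] := hS; apply/set_mem/SB; apply/mem_set.
    exact: Lx.
  exact: Ly.
- move=> x y /set_mem Lx /set_mem Ly; apply/mem_set => S hS.
  have [[_ _ SM] _] := hS; apply/set_mem/SM; apply/mem_set.
    exact: Lx.
  exact: Ly.
Qed.

Lemma laurentS n : laurent n `<=` laurent n.+1.
Proof.
apply: smallest_sub; first exact: laurent_subring.
have sub_gen : range iota `|` [set X n.+1; (X n.+1)^-1] `<=` laurent n.+1.
  exact: sub_smallest.
have [_ _ LM] := laurent_subring n.+1.
have sq x : laurent n.+1 x -> laurent n.+1 (x ^+ 2).
  by move=> Lx; apply/set_mem; rewrite expr2; apply: LM; apply/mem_set.
move=> z [Fz|[->|->]]; first by apply: sub_gen; left.
  by rewrite -dyadic_root_sqr; apply: sq; apply: sub_gen; right; left.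
by rewrite -dyadic_root_sqr -exprVn; apply: sq; apply: sub_gen; right; right.
Qed.

Lemma laurent_le m n : (m <= n)%N -> laurent m `<=` laurent n.
Proof.
move=> /subnK <-; elim: (n - m)%N => // k IH z /IH; exact: laurentS.
Qed.

Lemma dyadic_laurent_subring : GRing.subring_closed dyadic_laurent.
Proof.
have common x y : x \in dyadic_laurent -> y \in dyadic_laurent ->
    exists n, laurent n x /\ laurent n y.
  move=> /asboolP[m _ Lx] /asboolP[n _ Ly]; exists (maxn m n).
  by split; [apply: laurent_le Lx | apply: laurent_le Ly];
    rewrite ?leq_maxl ?leq_maxr.
split.
- by apply/asboolP; exists 0 => //; apply/set_mem; case: (laurent_subring 0).
- move=> x y Dx Dy; have [n [Lx Ly]] := common x y Dx Dy.
  apply/asboolP; exists n => //; apply/set_mem.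
  by case: (laurent_subring n) => _ LB _; apply: LB; apply/mem_set.
- move=> x y Dx Dy; have [n [Lx Ly]] := common x y Dx Dy.
  apply/asboolP; exists n => //; apply/set_mem.
  by case: (laurent_subring n) => _ _ LM; apply: LM; apply/mem_set.
Qed.

HB.instance Definition _ :=
  GRing.isSubringClosed.Build L dyadic_laurent dyadic_laurent_subring.

Definition dyadicLaurent : Type := {z : L | z \in dyadic_laurent}.

HB.instance Definition _ := SubChoice.on dyadicLaurent.
HB.instance Definition _ :=
  [SubChoice_isSubComNzRing of dyadicLaurent by <:].

Definition dl_unit : {pred dyadicLaurent} :=
  fun z : dyadicLaurent =>
  (val z != 0) && ((val z)^-1 \in dyadic_laurent).

Definition dl_inv (z : dyadicLaurent) : dyadicLaurent :=
  if dl_unit z then insubd z (val z)^-1 else z.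

Lemma dl_mulV : {in dl_unit, left_inverse 1 dl_inv *%R}.
Proof.
move=> z Uz; apply: val_inj; rewrite /dl_inv [dl_unit z]Uz /=.
by case/andP: Uz => z0 Dz; rewrite insubdK // mulVf.
Qed.

Lemma dl_unitP (x y : dyadicLaurent) : y * x = 1 -> dl_unit x.
Proof.
move=> /(congr1 val) /= yx.
have x0 : val x != 0 by apply: contra_eq_neq yx => ->; rewrite mulr0 eq_sym oner_eq0.
by rewrite /dl_unit x0 -[(val x)^-1]mul1r -yx mulfK // (valP y).
Qed.

Lemma dl_inv_out : {in [predC dl_unit], dl_inv =1 id}.
Proof. by move=> x /negbTE Ux; rewrite /dl_inv; rewrite [dl_unit x]Ux. Qed.

HB.instance Definition _ := GRing.ComNzRing_hasMulInverse.Build dyadicLaurent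
  dl_mulV dl_unitP dl_inv_out.

Lemma dl_integral : GRing.integral_domain_axiom dyadicLaurent.
Proof.
by move=> x y /(congr1 val)/eqP; rewrite /= mulf_eq0 => /orP[] /eqP e;
  apply/orP; [left | right]; apply/eqP/val_inj.
Qed.

HB.instance Definition _ :=
  GRing.ComUnitRing_isIntegral.Build dyadicLaurent dl_integral.

End DyadicLaurent.

(* Main.v *)
(* D is a Bezout domain, being a union of localized polynomial rings. As char F <> 2,
   the substitution of X^2 for X preserves radical polynomials prime to X, so every nonzero
   f in D has a radical divisor r with f | r^n.  For a proper ideal I containing r^(n+1),
   I = rad(I) (I : rad(I)) and the second factor contains r^n: D is an SP domain by
   induction on n.  Irreducible polynomials over F have bounded degree, so those of D_n
   split properly further up and every nonzero nonunit has two comaximal nonunit divisors.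
   Hence D has no irreducible element, a nonzero prime is not principal and so not
   invertible, and a nonzero nonunit lies in a Cantor tree of maximal ideals.

   Bounded degree, and 2 <> 0 when F is real closed, come from the finiteness of the
   algebraic closure K of F, the latter as in the Artin-Schreier theorem: in characteristic
   2 the extension K / F would be Galois, but an algebraically closed field of
   characteristic 2 has no automorphism of prime order.

   For (5), M is the union of principal ideals p_k D with p_(k+1) a proper divisor of p_k,
   and there are maximal ideals N_n containing p_k if and only if k <= n.  Reducing modulo
   N_n, for n along a nonprincipal ultrafilter, gives a valuation of D[[Y]] with values in
   an ultrapower of the natural numbers together with infinity; it is infinite on MD[[Y]],
   takes finite standard values outside M[[Y]], and every nondecreasing unbounded sequence
   is a value.  Cuts of the value set closed under addition give primes, and interpolation
   of rates of growth along the binary tree of height omega_1 gives a chain of 2^aleph_1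
   cuts. *)

Require Import Defs.
From HB Require Import structures.
From mathcomp Require Import all_boot all_order all_algebra all_fingroup all_solvable all_field.
From mathcomp Require Import ring_quotient generic_quotient fraction.
From mathcomp Require Import all_classical zify ring.
(* The files above shadow some names of [Defs], such as [proper_ideal]. *)
Require Import Defs.

Set Implicit Arguments.
Unset Strict Implicit.
Unset Printing Implicit Defensive.

Local Open Scope classical_set_scope.
Local Open Scope card_scope.

(** * The first uncountable ordinal *)

(** The step sees only the set of values at smaller arguments, which frees the recursion equation
    from accessibility proofs. The enumeration of well-orderings and the tree of growth functions
    depend on nothing more. *)
Lemma wf_rec (T U : Type) (lt : T -> T -> Prop) (step : T -> set U -> U) :
  well_founded lt ->
  exists g : T -> U, forall a, g a = step a [set g b | b in [set b | lt b a]].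
Proof.
move=> wf.
pose F a (rec : forall b, lt b a -> U) :=
  step a [set u | exists b (h : lt b a), u = rec b h].
exists (Fix wf (fun=> U) F) => a; rewrite Fix_eq.
  rewrite /F; congr step; apply/seteqP; split=> u /=.
    by move=> [b [h ->]]; exists b.
  by move=> [b h <-]; exists b, h.
by move=> x f g fg; congr F; apply/functional_extensionality_dep => y; apply/funext => h.
Qed.

Section WellOrder.
Variables (T : eqType) (r : rel T).
Hypothesis rwo : wochoice.well_order r.

Definition strict (x y : T) : Prop := r x y /\ x <> y.

Lemma wo_total x y : r x y || r y x.
Proof. by apply: (wochoice.wo_chainW (wochoice.withinW rwo)). Qed.

Lemma wo_anti x y : r x y -> r y x -> x = y.
Proof.
move=> xy yx.
by apply: (wochoice.wo_chain_antisymmetric (wochoice.withinW rwo) (x := x) (y := y)) => //;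
  rewrite ?inE ?xy ?yx.
Qed.

Lemma wo_min (A : set T) : A !=set0 -> exists2 z, A z & forall y, A y -> r z y.
Proof.
move=> [x Ax]; have [|z [[/asboolP Az zmin] _]] := rwo (A := fun x => `[< A x >]).
  by exists x; apply/asboolP.
by exists z => // y Ay; apply: zmin; apply/asboolP.
Qed.

Lemma strictP x y : ~ strict x y <-> r y x.
Proof.
split=> [nxy|yx [xy /[dup] ne]]; last by apply; apply: wo_anti.
have [->|/eqP ne] := eqVneq x y; first by have := wo_total y y; rewrite orbb.
by have /orP[xy|//] := wo_total x y; case: nxy; split.
Qed.

Lemma strict_tricho x y : [\/ strict x y, x = y | strict y x].
Proof.
have [->|/eqP ne] := eqVneq x y; first by constructor 2.
have /orP[xy|yx] := wo_total x y; [constructor 1|constructor 3]; split=> //.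
exact: nesym.
Qed.

Lemma wo_trans x y z : r x y -> r y z -> r x z.
Proof.
move=> xy yz; have [|m] := @wo_min [set x; y; z]; first by exists x; left; left.
move=> xyzm mmin.
have mx : r m x by apply: mmin; left; left.
have my : r m y by apply: mmin; left; right.
have mz : r m z by apply: mmin; right.
case: xyzm => [[|]|] e; rewrite e in mx my mz => //.
  by rewrite (wo_anti xy mx).
by rewrite (wo_anti yz my) in xy.
Qed.

Lemma strict_trans x y z : strict x y -> strict y z -> strict x z.
Proof.
move=> [xy nxy] [yz nyz]; split; first exact: wo_trans yz.
by move=> e; rewrite -e in yz; case: nxy; apply: wo_anti.
Qed.

Lemma strict_wf : well_founded strict.
Proof.
move=> a; apply: contrapT => na.
have [|z nz zmin] := @wo_min [set x | ~ Acc strict x]; first by exists a.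
apply: nz; constructor => y yz; apply: contrapT => /zmin /strictP; exact.
Qed.

End WellOrder.

Lemma uncountable_set_nat : ~ countable [set: set nat].
Proof.
move=> /countable_injP[f finj].
pose D : set nat := [set n | exists2 A : set nat, f A = n & ~ A n].
have [Df|nDf] := pselect (D (f D)); last by apply/nDf; exists D.
have [A fA] := Df; have -> : A = D by apply: finj; rewrite ?in_setT.
by apply.
Qed.

(* An initial segment [A] of a well-ordering of [set nat] of order type omega_1. *)
Lemma omega1 : exists (r : rel (set nat)) (A : set (set nat)),
  [/\ wochoice.well_order r, forall a b, strict r b a -> A a -> A b,
      forall a, A a -> countable [set b | strict r b a] & ~ countable A].
Proof.
have [r rwo] := wochoice.well_ordering_principle (set nat).
exists r.
have [allc|/existsNP nallc] := pselect (forall a, countable [set b | strict r b a]).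
  by exists setT; split=> //; exact: uncountable_set_nat.
(* The least point with uncountably many predecessors bounds a segment whose points all have
   countably many. *)
have [w nw wmin] := wo_min rwo nallc.
exists [set b | strict r b w]; split=> //.
  by move=> a b ba aw; apply: (strict_trans rwo ba).
by move=> a aw; apply: contrapT => /wmin /(strictP rwo).
Qed.

Section Embedding.
Variables (T : pointedType) (r : rel T) (A : set T).
Hypothesis rwo : wochoice.well_order r.
Hypothesis Adown : forall a b, strict r b a -> A a -> A b.
Hypothesis Aunc : ~ countable A.

(* Enumerating [A] along a well-ordering [s] of [nat] maps it onto a proper
   initial segment of [A]; the bound of that segment determines the order type. *)
Lemma wo_nat_segment (s : rel nat) : wochoice.well_order s ->
  exists (g : nat -> T) (a : T),
    [/\ A a, forall m n, s m n = r (g m) (g n) & range g = [set b | strict r b a]].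
Proof.
move=> swo.
(* The default [point] is never reached below, since [A] minus a countable set is nonempty. *)
pose least (S : set T) := xget point [set z | S z /\ forall y, S y -> r z y].
have leastP (C : set T) : countable C ->
    (A `\` C) (least (A `\` C)) /\ forall y, (A `\` C) y -> r (least (A `\` C)) y.
  move=> cC; rewrite /least; case: xgetP => [z _ //|no].
  have [|z z1 z2] := @wo_min T r rwo (A `\` C); last by case: (no z).
  apply/set0P/negP => /eqP AC; apply: Aunc; apply: sub_countable cC.
  apply/subset_card_le => x Ax; apply: contrapT => nCx.
  have : (A `\` C) x by split.
  by rewrite AC.
have [g gE] := wf_rec (fun=> fun C => least (A `\` C)) (strict_wf swo).
have gP n : A (g n) /\ (forall m, strict s m n -> g m <> g n) /\
    forall y, A y -> strict r y (g n) -> exists2 m, strict s m n & g m = y.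
  have [|] := leastP [set g b | b in [set b | strict s b n]].
    by apply: card_le_trans (card_image_le _ _) _; exact: countableP.
  rewrite -gE => -[Ag nseg] gmin; split=> //; split=> [m mn e|y Ay yg].
    by apply: nseg; exists m.
  apply: contrapT => ny; have /gmin : (A `\` [set g b | b in [set b | strict s b n]]) y.
    by split=> // -[m mn e]; apply: ny; exists m.
  by move/(strictP rwo)/(_ yg).
have gmono m n : strict s m n -> strict r (g m) (g n).
  move=> mn; have [_ [ne _]] := gP n; split; last exact: ne.
  apply/(strictP rwo) => /(gP m).2.2 [|k km ek]; first exact: (gP n).1.
  by apply: (ne k) => //; exact: strict_trans mn.
have [|[Aa nga] amin] := leastP (range g).
  by apply: card_le_trans (card_image_le _ _) _; exact: countableP.
exists g, (least (A `\` range g)); split=> //.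
  move=> m n; apply/idP/idP => [mn|].
    have [->|/eqP ne] := eqVneq m n; first by have := wo_total rwo (g n) (g n); rewrite orbb.
    by have [] : strict r (g m) (g n) by apply: gmono; split.
  move=> rmn; apply/(strictP swo) => /gmono nm.
  by move: rmn => /(strictP rwo); apply.
apply/seteqP; split=> [_ [n _ <-]|b /= ba].
  have [//|e|] := strict_tricho rwo (g n) (least (A `\` range g)).
    by case: nga; rewrite -e; exists n.
  by move=> /(gP n).2.2[//|m _ e]; case: nga; rewrite -e; exists m.
apply: contrapT => nb; have /amin : (A `\` range g) b by split=> //; exact: Adown ba Aa.
by move/(strictP rwo); apply.
Qed.

(** An order type goes to the bound of the initial segment of [A] that realizes it, and the segment
    recovers the order type. The least element of [A], whose segment is empty, is left for
    [None]. *)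
Lemma option_aleph1_inj : exists2 f : option aleph1 -> T, injective f & forall u, A (f u).
Proof.
have sP (u : aleph1) : exists s, wochoice.well_order s /\ order_type s = val u.
  by case: u => /= c; rewrite inE => -[s swo e]; exists s.
have [s /all_and2[swo sE]] := choice sP.
have [g /choice [a ga]] := choice (fun u => wo_nat_segment (swo u)).
have Ane : A !=set0 by apply/set0P/negP => /eqP A0; apply: Aunc; rewrite A0; exact: countable0.
have [a0 Aa0 a0min] := wo_min rwo Ane.
exists (fun u => if u is Some v then a v else a0); last by case=> [v|//]; case: (ga v).
have na0 u : a u <> a0.
  move=> e; have [_ _] := ga u; rewrite e => /seteqP[/(_ (g u 0%N))].
  have [Aa _ seg] := ga u.
  case=> [|/= b01 b02]; first by exists 0%N.
  have : A (g u 0%N).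
    apply: Adown Aa; have : range (g u) (g u 0%N) by exists 0%N.
    by rewrite seg.
  by move/a0min => h; case: b02; exact: (wo_anti rwo).
move=> [u|] [v|] //= e.
- congr Some; apply: val_inj => /=; rewrite -!sE.
  have [_ mu su] := ga u; have [_ mv sv] := ga v.
  have {}e : range (g u) = range (g v) by rewrite su sv e.
  have ginj w : injective (g w).
    have [_ mw _] := ga w; move=> x y exy; apply: (wo_anti (swo w)).
      by rewrite mw exy; have := wo_total rwo (g w y) (g w y); rewrite orbb.
    by rewrite mw exy; have := wo_total rwo (g w y) (g w y); rewrite orbb.
  have tr (w w' : aleph1) : range (g w) = range (g w') -> exists h, forall n, g w' (h n) = g w n.
    move=> eww; suff /choice[h hE] : forall n, exists m, g w' m = g w n by exists h.
    move=> n; have : range (g w) (g w n) by exists n.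
    by rewrite eww => -[m _ <-]; exists m.
  have [h hE] := tr _ _ e; have [h' h'E] := tr _ _ (esym e).
  have sim : similar (s u) (s v).
    exists h; last by move=> x y; rewrite mu mv !hE.
    by exists h'; move=> n; [apply: (ginj u) | apply: (ginj v)]; rewrite ?hE h'E ?hE.
  have sim' : similar (s v) (s u).
    exists h'; last by move=> x y; rewrite mu mv !h'E.
    by exists h; move=> n; [apply: (ginj v) | apply: (ginj u)]; rewrite ?h'E hE ?h'E.
  have tsim (p q t : rel nat) : similar p q -> similar q t -> similar p t.
    move=> [x bx mx] [y bY my]; exists (y \o x); first exact: bij_comp.
    by move=> i j /=; rewrite my mx.
  by apply/seteqP; split=> t; [apply: tsim | apply: tsim].
- by case: (na0 u).
- by case: (na0 v).
Qed.

End Embedding.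

(** * Rates of growth *)

(** That is, phi + 1 = o(psi). With the successor, the zero function is dominated exactly by the
    functions that tend to infinity. *)
Definition dominated (phi psi : nat -> nat) : Prop :=
  forall k, exists N, forall n, N <= n -> k * (phi n).+1 <= psi n.

Definition nondecr (phi : nat -> nat) : Prop := {homo phi : m n / m <= n}.

Lemma dominated_trans phi psi chi :
  dominated phi psi -> dominated psi chi -> dominated phi chi.
Proof.
move=> h1 h2 k; have [N hN] := h1 k; have [N' hN'] := h2 1%N.
exists (maxn N N') => n; rewrite geq_max => /andP[/hN a /hN' b]; lia.
Qed.

(* du Bois-Reymond's diagonal argument: [c n] is the largest of the [k * (a i n).+1] with
   [i <= k], where [k <= n] ranges over the indices for which [n] is past the point [N k]
   from which these values, times [k], stay below [b j] for all [j <= k]. *)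
Lemma dominated_interpolation (a b : nat -> nat -> nat) :
  (forall i, nondecr (a i)) -> (forall i j, dominated (a i) (b j)) ->
  exists c, [/\ nondecr c, forall i, dominated (a i) c & forall j, dominated c (b j)].
Proof.
move=> am ab.
have thr k : exists N, forall n, N <= n -> forall i j, i <= k -> j <= k ->
    k * (k * (a i n).+1).+1 <= b j n.
  have thr1 i j : exists N, forall n, N <= n -> k * (k * (a i n).+1).+1 <= b j n.
    (* As [(a i n).+1] is at least 1, the summand [k] of the factor absorbs the outer successor. *)
    have [N hN] := ab i j (k * k + k)%N; exists N => n /hN; nia.
  have /choice[N hN] : forall i, exists N, forall j n, N j <= n ->
      k * (k * (a i n).+1).+1 <= b j n.
    by move=> i; have [N] := choice (thr1 i); exists N.
  exists (\max_(i < k.+1) \max_(j < k.+1) N i j) => n Nn i j ik jk.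
  apply: hN; apply: leq_trans Nn.
  have ik' : i < k.+1 by []. have jk' : j < k.+1 by [].
  apply: (bigmax_sup (Ordinal ik')) => //=.
  by apply: (bigmax_sup (Ordinal jk')).
have [N hN] := choice thr.
pose c n := \max_(k < n.+1 | N k <= n) \max_(i < k.+1) k * (a i n).+1.
have cge n k i : k <= n -> N k <= n -> i <= k -> k * (a i n).+1 <= c n.
  move=> kn Nn ik; have kn' : k < n.+1 by []. have ik' : i < k.+1 by [].
  apply: (bigmax_sup (Ordinal kn')) => //=.
  by apply: (bigmax_sup (Ordinal ik')).
have cle n m : (forall k i, k <= n -> N k <= n -> i <= k -> k * (a i n).+1 <= m) -> c n <= m.
  move=> H; apply/bigmax_leqP => k Nk; apply/bigmax_leqP => i _.
  by apply: H => //; rewrite -ltnS.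
exists c; split.
- move=> m n mn; apply: cle => k i km Nk ik.
  apply: leq_trans (cge n k i (leq_trans km mn) (leq_trans Nk mn) ik).
  by rewrite leq_mul2l ltnS am ?orbT.
- move=> i K; exists (maxn (maxn K i) (N (maxn K i))) => n; rewrite geq_max => /andP[h1 h2].
  apply: leq_trans (cge n (maxn K i) i h1 h2 (leq_maxr _ _)).
  by rewrite leq_mul2r leq_maxl orbT.
- move=> j K; exists (N (maxn K j)) => n Nn; set k0 := maxn K j in Nn.
  have Kk0 : K <= k0 by apply: leq_maxl.
  have jk0 : j <= k0 by apply: leq_maxr.
  have [->//|K0] := posnP K.
  rewrite mulnC -leq_divRL //.
  suff : c n <= (b j n %/ K).-1.
    suff : 0 < b j n %/ K by lia.
    rewrite divn_gt0 //; have := hN _ _ Nn 0%N j isT jk0; nia.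
  apply: cle => k i kn Nk ik.
  suff : K * (k * (a i n).+1).+1 <= b j n.
    by rewrite mulnC -leq_divRL //; lia.
  (* Terms of index at most [k0] are bounded past the threshold of [k0], later terms past their own
     threshold. *)
  have [kk0|/ltnW k0k] := leqP k k0.
    have := hN _ _ Nn i j (leq_trans ik kk0) jk0.
    have : k * (a i n).+1 <= k0 * (a i n).+1 by rewrite leq_mul2r kk0 orbT.
    nia.
  have := hN _ _ Nk i j ik (leq_trans jk0 k0k).
  by have := leq_trans Kk0 k0k; nia.
Qed.

Lemma dominated_between (S : set ((nat -> nat) * (nat -> nat))) :
  countable S -> S !=set0 -> (forall p, S p -> nondecr p.1) ->
  (forall p q, S p -> S q -> dominated p.1 q.2) ->
  exists c, [/\ nondecr c, forall p, S p -> dominated p.1 c & forall p, S p -> dominated c p.2].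
Proof.
move=> cS [p0 Sp0] Sm SS.
have /pfcard_geP[S0|[g]] := cS; first by rewrite S0 in Sp0.
have gS n : S (g n) by apply: funS.
have [|i j|c [c1 c2 c3]] := @dominated_interpolation (fun i => (g i).1) (fun j => (g j).2).
- by move=> i; apply: Sm.
- exact: SS.
exists c; split=> // p Sp.
  by have [n _ <-] : range g p by apply: surj.
by have [n _ <-] : range g p by apply: surj.
Qed.

(** * Nested intervals of growth functions along a binary tree *)

Section Tree.
Variables (T : Type) (lt : T -> T -> Prop) (A : set T).
Hypothesis ltwf : well_founded lt.
Hypothesis lttrans : forall x y z, lt x y -> lt y z -> lt x z.
Hypothesis lttotal : forall x y, [\/ lt x y, x = y | lt y x].
Hypothesis Adown : forall a b, lt b a -> A a -> A b.
Hypothesis Acount : forall a, A a -> countable [set b | lt b a].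

Local Notation pair := ((nat -> nat) * (nat -> nat))%type.

(* Binary tree of height [A] of nested intervals of growth functions; the branch
   [x] follows at [a] the upper or lower half according to whether [a] is in [x]. *)
Lemma dominated_tree : exists v : set T -> T -> pair,
  [/\ forall x a, A a -> nondecr (v x a).1 /\ dominated (fun=> 0%N) (v x a).1,
      forall x a b, A a -> lt b a -> dominated (v x b).1 (v x a).1 &
      forall x y a, A a -> (forall b, lt b a -> x b <-> y b) -> ~ x a -> y a ->
        forall b, A b -> dominated (v x b).1 (v y a).1].
Proof.
(* A node inserts three functions into all earlier intervals and takes [(m, h)] or [(l, m)] as its
   own, so branches that part there are separated by [m]. *)
pose between (S : set pair) (lmh : (nat -> nat) * pair) :=
  let: (l, (m, h)) := lmh in
  [/\ nondecr l, nondecr m, dominated l m, dominated m h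
    & forall p, S p -> dominated p.1 l /\ dominated h p.2].
pose triple0 : (nat -> nat) * ((nat -> nat) * (nat -> nat)) := (id, (id, id)).
pose step (x : set T) a (S : set pair) : pair :=
  (* The root interval, from the zero function to the identity, makes the set of constraints
     nonempty at the least node and all lower ends divergent. The default [triple0] is not reached
     on [A]. *)
  let: (l, (m, h)) := xget triple0 (between ((fun=> 0%N, id) |` S)) in
  if `[< x a >] then (m, h) else (l, m).
have [v vE] := choice (fun x => wf_rec (step x) ltwf).
pose low x a := (v x a).1; pose high x a := (v x a).2.
pose S x a : set pair := (fun=> 0%N, id) |` [set v x b | b in [set b | lt b a]].
have zero_id : dominated (fun=> 0%N) id.
  by move=> k; exists k => n; rewrite muln1.
have main x a : A a -> exists l m h, between (S x a) (l, (m, h)) /\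
    [/\ v x a = (if `[< x a >] then (m, h) else (l, m)) &
        xget triple0 (between (S x a)) = (l, (m, h))].
  elim/(well_founded_ind ltwf): a => a IH Aa.
  suff [l [m [h Hb]]] : exists l m h, between (S x a) (l, (m, h)).
    move: (vE x a); rewrite /step -/(S x a).
    case: xgetP => [[l' [m' h']] _ Hb' e|/(_ (l, (m, h)))//].
    by exists l', m', h'.
  have valid b : lt b a -> [/\ nondecr (low x b), dominated (low x b) (high x b),
      dominated (fun=> 0%N) (low x b), dominated (high x b) id &
      forall c, lt c b -> dominated (low x c) (low x b) /\ dominated (high x b) (high x c)].
    move=> ba; have [l [m [h [[lm mm lm' mh Sb] [e _]]]]] := IH b ba (Adown ba Aa).
    have [Sl0 Sh0] := Sb _ (or_introl erefl).
    have Sc c : lt c b -> dominated (low x c) l /\ dominated h (high x c).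
      by move=> cb; apply: Sb; right; exists c.
    rewrite /low /high e; case: ifP => _ /=; split=> //.
    - exact: dominated_trans lm'.
    - by move=> c /Sc[h1 h2]; split=> //; apply: dominated_trans lm'.
    - exact: dominated_trans Sh0.
    - by move=> c /Sc[h1 h2]; split=> //; apply: dominated_trans h2.
  have Scount : countable (S x a).
    rewrite /S -bigcup2E; apply: bigcup_countable; first exact: countableP.
    move=> [|[|n]] _ /=; [exact: countable1| |exact: countable0].
    by apply: card_le_trans (card_image_le _ _) _; exact: Acount.
  have Snondecr p : S x a p -> nondecr p.1.
    by case=> [->//|[b ba <-]]; case: (valid b ba).
  have Snest p q : S x a p -> S x a q -> dominated p.1 q.2.
    move=> [->|[b ba <-]] [->|[c ca <-]] //=.
    - by have [_ h1 h2 _ _] := valid c ca; apply: dominated_trans h1.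
    - by have [_ h1 _ h2 _] := valid b ba; apply: dominated_trans h2.
    have [_ hb _ _ Hb] := valid b ba; have [_ hc _ _ Hc] := valid c ca.
    have [bc|->//|cb] := lttotal b c.
      by apply: dominated_trans hc; case: (Hc b bc).
    by apply: dominated_trans hb _; case: (Hb c cb).
  have S0 : S x a !=set0 by exists (fun=> 0%N, id); left.
  (* First [m] is placed between all lower and upper ends; then [m] replaces the upper ends to give
     [l], and the lower ends to give [h]. *)
  have [m [m1 m2 m3]] := dominated_between Scount S0 Snondecr Snest.
  pose Sl : set pair := [set (p.1, m) | p in S x a].
  have [|||p q|l [l1 l2 l3]] := @dominated_between Sl.
  - by apply: card_le_trans (card_image_le _ _) _.
  - by have [p Sp] := S0; exists (p.1, m); exists p.
  - by move=> _ [p Sp <-] /=; exact: Snondecr.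
  - by move=> [p' Sp' <-] [q' Sq' <-] /=; exact: m2.
  pose Sh : set pair := [set (m, p.2) | p in S x a].
  have [|||p q|h [h1 h2 h3]] := @dominated_between Sh.
  - by apply: card_le_trans (card_image_le _ _) _.
  - by have [p Sp] := S0; exists (m, p.2); exists p.
  - by move=> _ [p Sp <-].
  - by move=> [p' Sp' <-] [q' Sq' <-] /=; exact: m3.
  have [p0 Sp0] := S0.
  exists l, m, h; split=> //.
  - by apply: (l3 (p0.1, m)); exists p0.
  - by apply: (h2 (m, p0.2)); exists p0.
  by move=> p Sp; split; [apply: (l2 (p.1, m)); exists p | apply: (h3 (m, p.2)); exists p].
have nest x a b : A a -> lt b a ->
    dominated (low x b) (low x a) /\ dominated (high x a) (high x b).
  move=> Aa ba; have [l [m [h [[lm mm lm' mh Sb] [e _]]]]] := main x a Aa.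
  have [h1 h2] : dominated (low x b) l /\ dominated h (high x b).
    by apply: Sb; right; exists b.
  rewrite /low /high e; case: ifP => _ /=; split=> //; first exact: dominated_trans lm'.
  exact: dominated_trans h2.
exists v; split.
- move=> x a Aa; have [l [m [h [[lm mm lm' mh Sb] [e _]]]]] := main x a Aa.
  have [Sl0 _] := Sb _ (or_introl erefl).
  by rewrite e; case: ifP => _ //=; split=> //; exact: dominated_trans lm'.
- by move=> x a b Aa ba; case: (nest x a b Aa ba).
move=> x y a Aa agree nxa ya.
(* The triple at a node is a function of the set of earlier intervals, so branches that agree below
   [a] choose the same triple at [a]. *)
have vagree b : A b -> (forall c, lt c b -> x c <-> y c) -> S x b = S y b.
  elim/(well_founded_ind ltwf): b => b IH Ab xyb; rewrite /S; congr (_ |` _).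
  apply: eq_imagel => c cb; have Ac := Adown cb Ab.
  rewrite !vE /step -!/(S _ _) (IH c cb Ac); last first.
    by move=> d dc; apply: xyb; apply: lttrans cb.
  by rewrite (propext (xyb c cb)).
have [l [m [h [[lm mm lm' mh Sb] [e eg]]]]] := main x a Aa.
have [l' [m' [h' [_ [e' eg']]]]] := main y a Aa.
have := eg'; rewrite -(vagree a Aa agree) eg => -[el em eh].
rewrite asboolT // in e'; rewrite asboolF // in e.
move=> b Ab; rewrite e' /= -em.
have [ba|->|ab] := lttotal b a.
- apply: dominated_trans lm'.
  by apply: (Sb (v x b) _).1; right; exists b.
- by rewrite e.
have [_ hh] := nest x b a Ab ab; rewrite /high e /= in hh; apply: dominated_trans hh.
have [l1 [m1 [h1 [[_ _ k1 k2 _] [e1 _]]]]] := main x b Ab.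
by rewrite e1; case: ifP => _ /=.
Qed.

End Tree.

(** * Long chains of primes in a power series ring *)

Import GRing.Theory.
Local Open Scope ring_scope.
Local Open Scope quotient_scope.

Lemma card_le_inj (T U : Type) (f : T -> U) (B : set U) :
  injective f -> (forall x, B (f x)) -> [set: T] #<= B.
Proof.
move=> finj Bf; apply: (@card_le_trans _ _ _ (f @` setT)).
  by rewrite (card_le_eqr (inj_card_eq _)) // => x y _ _; exact: finj.
by apply: subset_card_le => _ [x _ <-].
Qed.

(** As length is cardinality minus one, a chain of length 2^T has 2^T + 1 members; subsets of
    [option T] leave room for the additional one, for finite [T] too. *)
Lemma option_set_inj (T : Type) : exists f : option (set T) -> set (option T), injective f.
Proof.
exists (fun o => if o is Some A then some @` A else [set None]).
have ne (A : set T) : some @` A <> [set None].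
  by move=> e; have : [set (None : option T)] None by []; rewrite -e => -[].
move=> [A|] [A'|] //= e.
- congr Some; apply/seteqP; split=> x Sx.
    by have : (some @` A) (Some x) by [exists x]; rewrite e => -[y Sy [<-]].
  by have : (some @` A') (Some x) by [exists x]; rewrite -e => -[y Sy [<-]].
- by case: (ne A).
- by case: (ne A').
Qed.

Lemma dim_ge_family (R : comNzRingType) (T : Type) (Q : set (option T) -> set R) :
  (forall x, prime_ideal (Q x)) -> injective Q ->
  (forall x y, Q x `<=` Q y \/ Q y `<=` Q x) -> dim_ge R (set T).
Proof.
move=> Qprime Qinj Qtot; have [f finj] := option_set_inj T.
exists (range Q).
  split; first by exists (Q set0), set0.
    by move=> _ [x _ <-].
  by move=> _ _ [x _ <-] [y _ <-].
apply: (@card_le_inj _ _ (Q \o f)); first exact: inj_comp.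
by move=> x; exists (f x).
Qed.

(** * Passage of primes to a quotient and to a localization *)

Section Transfer.
Variable R : comNzRingType.

Definition quot_ideal (I : set R) (hI : proper_ideal I) (Q : set R) : set (ideal_quotient hI) :=
  [set \pi_(ideal_quotient hI) a | a in Q].
Arguments quot_ideal {I} hI Q _.

Lemma quot_idealP (I : set R) (hI : proper_ideal I) (Q : set R) a :
  ideal Q -> I `<=` Q -> quot_ideal hI Q (\pi a) <-> Q a.
Proof.
move=> hQ IQ; split=> [[b Qb /eqP]|Qa]; last by exists a.
rewrite -Quotient.idealrBE => /asboolP Iba.
by rewrite -(subKr b a); exact: (idealB hQ Qb (IQ _ Iba)).
Qed.

Lemma quot_ideal_prime (I : set R) (hI : proper_ideal I) (Q : set R) :
  prime_ideal Q -> I `<=` Q -> prime_ideal (quot_ideal hI Q).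
Proof.
move=> [[hQ Q1] Qprime] IQ; have [Q0 QD QM] := hQ.
have qP a := quot_idealP hI a hQ IQ.
split; last first.
  elim/quotW => a; elim/quotW => b; rewrite -rmorphM => /qP.
  by case/Qprime => [Qa|Qb]; [left|right]; apply/qP.
split; last by rewrite -(rmorph1 (\pi_(ideal_quotient hI))) => /qP.
split.
- by exists 0; rewrite ?rmorph0.
- by move=> _ _ [a Qa <-] [b Qb <-]; rewrite -rmorphD; apply/qP/QD.
- by elim/quotW => a _ [b Qb <-]; rewrite -rmorphM; apply/qP/QM.
Qed.

Section Loc.
Variables (P : set R) (hP : prime_ideal P).

(** The extension of [Q], read off the numerator of the chosen representative. For a prime [Q]
    inside [P] any other fraction gives the same answer, because denominators lie outside [P], hence
    outside [Q]. *)
Definition loc_ideal (Q : set R) : set (localization hP) :=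
  [set x | Q (repr x).1].

Lemma loc_idealP (Q : set R) (x : loc_frac hP) :
  prime_ideal Q -> Q `<=` P -> loc_ideal Q (\pi_(localization hP) x) <-> Q x.1.
Proof.
move=> [[hQ Q1] Qprime] QP; have [Q0 QD QM] := hQ.
rewrite /loc_ideal /=; have [u nu e] := loc_reprP x.
set y := repr _ in e *.
have nPQ (z w v : R) (nz : ~ P z) (nw : ~ P w) : Q (z * (v * w)) -> Q v.
  by case/Qprime => [/QP//|] /Qprime[//|/QP].
split=> [Qy|Qx].
  by apply: (nPQ u (sval y.2)) => //; [exact: denP|rewrite e; apply: (QM); rewrite mulrC; apply: QM].
by apply: (nPQ u (sval x.2)) => //; [exact: denP|rewrite -e; apply: (QM); rewrite mulrC; apply: QM].
Qed.

Lemma loc_ideal_prime (Q : set R) :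
  prime_ideal Q -> Q `<=` P -> prime_ideal (loc_ideal Q).
Proof.
move=> hQ QP; have [[[Q0 QD QM] Q1] Qprime] := hQ.
have qP x := loc_idealP x hQ QP.
split; last first.
  elim/quotW => a; elim/quotW => b.
  by rewrite [X in loc_ideal _ X]piE => /qP /Qprime[] ?; [left|right]; apply/qP.
split; last by rewrite [X in loc_ideal _ X]piE => /qP.
split.
- by rewrite [X in loc_ideal _ X]piE; apply/qP.
- elim/quotW => a; elim/quotW => b /qP Qa /qP Qb; rewrite [X in loc_ideal _ X]piE; apply/qP.
  by apply: QD; rewrite mulrC; apply: QM.
- by elim/quotW => a; elim/quotW => b /qP Qb; rewrite [X in loc_ideal _ X]piE; apply/qP/QM.
Qed.

Lemma loc_ideal_inj (Q Q' : set R) : prime_ideal Q -> Q `<=` P ->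
  prime_ideal Q' -> Q' `<=` P -> loc_ideal Q = loc_ideal Q' -> Q = Q'.
Proof.
move=> hQ QP hQ' QP' e; apply/seteqP; split=> a Qa.
  by apply/(loc_idealP (frac_of hP a) hQ' QP'); rewrite -e; apply/loc_idealP.
by apply/(loc_idealP (frac_of hP a) hQ QP); rewrite e; apply/loc_idealP.
Qed.

End Loc.
End Transfer.
Arguments quot_ideal {R I} hI Q _.
Arguments loc_ideal {R P} hP Q _.

(** Primes between the extension of [M] and M[[Y]] stay prime and distinct modulo the former and
    then in the localization at the image of the latter. *)
Lemma ht_ge_series_quot (R : comNzRingType) (M : set R) (hM : prime_ideal M) (T : Type)
    (Q : set (option T) -> set (powerSeries R)) :
  (forall x, prime_ideal (Q x)) -> injective Q ->
  (forall x y, Q x `<=` Q y \/ Q y `<=` Q x) ->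
  (forall x, extended_ideal M `<=` Q x) -> (forall x, Q x `<=` series_ideal M) ->
  ht_ge (series_quot_prime hM) (set T).
Proof.
move=> Qprime Qinj Qtot MQ QM.
pose hE := extended_ideal_proper hM.
have QS x : quot_ideal hE (Q x) `<=` series_quot hM.
  by move=> _ [a Qa <-]; exists a => //; exact: QM Qa.
have qprime x : prime_ideal (quot_ideal hE (Q x)) by apply: quot_ideal_prime.
apply: (@dim_ge_family _ _ (fun x => loc_ideal (series_quot_prime hM) (quot_ideal hE (Q x)))).
- by move=> x; apply: loc_ideal_prime.
- move=> x y /loc_ideal_inj e; apply: Qinj.
  have {}e := e (qprime x) (@QS x) (qprime y) (@QS y).
  have qP z a : quot_ideal hE (Q z) (\pi a) <-> Q z a.
    by apply: quot_idealP => //; case: (Qprime z) => -[].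
  by apply/seteqP; split=> a Qa; apply/qP; [rewrite -e|rewrite e]; apply/qP.
move=> x y; have [xy|yx] := Qtot x y; [left|right] => z [a Qa e].
  by exists a => //; apply: xy.
by exists a => //; apply: yx.
Qed.

(** * Primes given by cuts in an ultrapower of the natural numbers *)

Section Cut.
Variables (R : comNzRingType) (N : nat -> set R) (U : set_system nat).
Hypothesis Nprime : forall n, prime_ideal (N n).
Hypothesis Uultra : UltraFilter U.
Hypothesis Ufree : \oo `<=` U.

Implicit Type L : set (nat -> nat).

(* The series whose order modulo [N n], as an element of the ultrapower of nat,
   exceeds every element of [L]. *)
Definition cut_ideal L : set (powerSeries R) :=
  [set f | forall phi, L phi -> U [set n | forall i, (i <= phi n)%N -> N n (f i)]].

(** Orders modulo a prime add: if [a] and [b] are the first indices of coefficients outside [P],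
    every term of the coefficient of index [a + b] except [f a * g b] lies in [P]. *)
Lemma order_mul (P : set R) (f g : powerSeries R) (m n : nat) : prime_ideal P ->
  (exists2 i, (i <= m)%N & ~ P (f i)) -> (exists2 i, (i <= n)%N & ~ P (g i)) ->
  exists2 i, (i <= m + n)%N & ~ P ((f * g) i).
Proof.
move=> hP [i im nfi] [j jn ngj]; have [[hPI P1] Pprime] := hP.
have first_out (h : powerSeries R) k : ~ P (h k) -> exists l,
    [/\ (l <= k)%N, ~ P (h l) & forall l', (l' < l)%N -> P (h l')].
  move=> nk; have ex : exists k, ~~ `[< P (h k) >] by exists k; apply/asboolP.
  have [l /asboolP nl lmin] := ex_minnP ex; exists l; split=> //.
    by apply: lmin; apply/asboolP.
  move=> l'; apply: contraPP => nl'; rewrite ltnNge; apply/negP/negPn/lmin.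
  exact/asboolP.
have [a [ai nfa amin]] := first_out f i nfi.
have [b [bj ngb bmin]] := first_out g j ngj.
exists (a + b)%N; first by rewrite leq_add // (leq_trans _ im, leq_trans _ jn).
have a_lt : (a < (a + b).+1)%N by rewrite ltnS leq_addr.
rewrite /GRing.mul /= /ps_mul (bigD1 (Ordinal a_lt)) //= addKn.
set S := \sum_(k | _) _ => PS'.
have PS : P S.
  apply: ideal_sum => // k neq_ka; have [_ _ PM] := hPI.
  have [ka|] := ltnP k a; first by rewrite mulrC; apply/PM/amin.
  rewrite leq_eqVlt eq_sym => /orP[/eqP eka|ak].
    by case/eqP: neq_ka; apply: val_inj.
  by apply/PM/bmin; rewrite ltn_subLR ?ltn_add2r // -ltnS.
have := idealB hPI PS' PS; rewrite addrK.
by case/Pprime.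
Qed.

Lemma ultra_not (A : set nat) : ~ U A -> U (~` A).
Proof. by move=> nA; have [//|] := in_ultra_setVsetC A Uultra. Qed.

(** The ultrafilter turns nonmembership of [f] and [g] into bounds [phi] and [psi] on their orders
    along sets of [U]. The order of the product is then at most [chi], up to a finite set that the
    free [U] ignores. *)
Lemma cut_ideal_prime L : L !=set0 ->
  (forall phi psi, L phi -> L psi -> exists2 chi, L chi &
     exists k, forall n, (k <= n)%N -> (phi n + psi n <= chi n)%N) ->
  prime_ideal (cut_ideal L).
Proof.
move=> [phi0 L0] Ldir.
have U0 : ~ U set0 by exact: filter_not_empty.
split; [split; [split|]|].
- by move=> phi _; apply: filterS filterT => n _ i _; case: (Nprime n) => -[[]].
- move=> f g Cf Cg phi Lphi; apply: filterS (filterI (Cf _ Lphi) (Cg _ Lphi)).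
  move=> n [fn gn] i ile; have [[[_ ND _] _] _] := Nprime n.
  by apply: ND; [exact: fn | exact: gn].
- move=> f g Cg phi Lphi; apply: filterS (Cg _ Lphi) => n gn i ile.
  have [[NI _] _] := Nprime n; have [_ _ NM] := NI.
  by apply: ideal_sum => // j _; apply/NM/gn; apply: leq_trans ile; apply: leq_subr.
- move=> /(_ _ L0); apply: contra_not U0; apply: filterS => n /(_ 0%N isT).
  by have [[_ +] _] := Nprime n.
move=> f g Cfg; apply: contrapT => /not_orP[/existsNP[phi /not_implyP[Lphi nf]]].
move=> /existsNP[psi /not_implyP[Lpsi ng]].
have [chi Lchi [k kchi]] := Ldir _ _ Lphi Lpsi.
apply: U0; have Uk : U [set n | (k <= n)%N] by apply: Ufree; exists k.
apply: filterS (filterI (filterI (ultra_not nf) (ultra_not ng)) (filterI (Cfg _ Lchi) Uk)).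
move=> n /= [[/existsNP[i /not_implyP[i1 i2]] /existsNP[j /not_implyP[j1 j2]]]] [fgn kn].
have [||l lle] := @order_mul (N n) f g (phi n) (psi n) (Nprime n); [by exists i|by exists j|].
apply; apply: fgn; exact: leq_trans (kchi n kn).
Qed.

Variable p : nat -> R.
Hypothesis Np : forall n k, N n (p k) <-> (k <= n)%N.

(** The coefficient of index [i] is [p m] for the least [m] with [i < phi m]; it lies in [N n]
    exactly when [m <= n]. *)
Lemma series_of_order (phi : nat -> nat) : nondecr phi ->
  (forall k, exists n, (k < phi n)%N) ->
  exists f : powerSeries R, forall n i, N n (f i) <-> (i < phi n)%N.
Proof.
move=> phim phiu; exists (fun i => p (ex_minn (phiu i))) => n i.
case: ex_minnP => m im mmin; split=> [/Np mn|]; last by move=> /mmin mn; apply/Np.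
exact: leq_trans im (phim _ _ mn).
Qed.

(** The series with all coefficients in [N n] for all large [n], uniformly in the index, form an
    ideal that contains the constants from [M]. *)
Lemma cut_ideal_extended (M : set R) L :
  (forall a, M a -> exists k, forall n, (k <= n)%N -> N n a) ->
  extended_ideal M `<=` cut_ideal L.
Proof.
move=> MN; pose J : set (powerSeries R) :=
  [set f | exists k, forall n, (k <= n)%N -> series_ideal (N n) f].
have JC : J `<=` cut_ideal L.
  move=> f [k Jf] phi _; apply: Ufree; exists k => // n /= kn i _; exact: Jf.
apply: subset_trans JC; apply: smallest_sub; last first.
  move=> _ [a Ma <-]; have [k Nk] := MN a Ma; exists k => n kn [|i] /=; first exact: Nk.
  by case: (Nprime n) => -[[]].
split.
- by exists 0%N => n _ i; case: (Nprime n) => -[[]].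
- move=> f g [k fk] [l gl]; exists (maxn k l) => n; rewrite geq_max => /andP[kn ln].
  have [[NI _] _] := Nprime n; have [_ SD _] := series_idealP NI.
  by apply: SD; [exact: fk | exact: gl].
move=> f g [k gk]; exists k => n kn; have [[NI _] _] := Nprime n.
by have [_ _ SM] := series_idealP NI; apply/SM/gk.
Qed.

(** If [f i] is outside [M], then 1 = m + a f_i with m in [M]. For many [n] both m and f_i lie in
    [N n], a contradiction. *)
Lemma cut_ideal_series (M : set R) L : maximal_ideal M ->
  (forall a, M a -> exists k, forall n, (k <= n)%N -> N n a) ->
  (exists2 phi, L phi & forall i, exists k, forall n, (k <= n)%N -> (i <= phi n)%N) ->
  cut_ideal L `<=` series_ideal M.
Proof.
move=> [[MI M1] Mmax] MN [phi Lphi phiu] f Cf i; apply: contrapT => nMf.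
have [M0 MD MM] := MI.
pose J : set R := [set z | exists m a, M m /\ z = m + a * f i].
have [J1|nJ1] := pselect (J 1); last first.
  apply: nMf; rewrite -(Mmax J).
  - by exists 0, 1; rewrite mul1r add0r.
  - split=> //; split; first by exists 0, 0; rewrite mul0r addr0.
      move=> _ _ [m [a [Mm ->]]] [m' [a' [Mm' ->]]]; exists (m + m'), (a + a').
      by rewrite mulrDl addrACA; split=> //; apply: MD.
    move=> b _ [m [a [Mm ->]]]; exists (b * m), (b * a).
    by rewrite mulrDr mulrA; split=> //; apply: MM.
  - by move=> m Mm; exists m, 0; rewrite mul0r addr0.
have [m [a [Mm e]]] := J1; have [k Nk] := MN m Mm; have [l phil] := phiu i.
have U0 : ~ U set0 by exact: filter_not_empty.
apply: U0; have Uk : U [set n | (maxn k l <= n)%N] by apply: Ufree; exists (maxn k l).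
apply: filterS (filterI (Cf _ Lphi) Uk) => n /= [fn]; rewrite geq_max => /andP[kn ln].
have [[[N0 ND NM] N1] _] := Nprime n; apply: N1; rewrite e.
by apply: ND; [exact: Nk | apply/NM/fn/phil].
Qed.

End Cut.

Lemma prime_family (R : comNzRingType) (M : set R) (N : nat -> set R) (p : nat -> R) :
  maximal_ideal M -> (forall n, prime_ideal (N n)) ->
  (forall n k, N n (p k) <-> (k <= n)%N) ->
  (forall a, M a -> exists k, forall n, (k <= n)%N -> N n a) ->
  exists Q : set (option aleph1) -> set (powerSeries R),
  [/\ forall x, prime_ideal (Q x), injective Q,
      forall x y, Q x `<=` Q y \/ Q y `<=` Q x,
      forall x, extended_ideal M `<=` Q x & forall x, Q x `<=` series_ideal M].
Proof.
move=> hM Nprime Np MN.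
have [r [A [rwo Adown Acount Aunc]]] := omega1.
have [h hinj hA] := option_aleph1_inj rwo Adown Aunc.
have [v [v1 v2 v3]] := dominated_tree (strict_wf rwo) (@strict_trans _ _ rwo)
  (strict_tricho rwo) Adown Acount.
have [U [Uultra Ufree]] := ultraFilterLemma eventually_filter.
(* The cut of a branch consists of the multiples of its lower ends; it is closed under addition up
   to domination because the lower ends increase along the branch. *)
pose L x : set (nat -> nat) :=
  [set phi | exists k a, A a /\ phi = fun n => (k * (v x a).1 n)%N].
have Q2 x : prime_ideal (cut_ideal N U (L x)).
  apply: cut_ideal_prime => //.
    by exists (fun n => 1 * (v x (h None)).1 n)%N, 1%N, (h None).
  move=> _ _ [k [a [Aa ->]]] [l [b [Ab ->]]].
  wlog [ab|<-] : k l a b Aa Ab / strict r a b \/ a = b.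
    move=> wlogh; have [ab|ab|ba] := strict_tricho rwo a b.
    - by apply: wlogh => //; left.
    - by apply: wlogh => //; right.
    have [|chi Lchi [K HK]] := wlogh l k b a Ab Aa; first by left.
    by exists chi => //; exists K => n; rewrite addnC; exact: HK.
  - exists (fun n => (k + l) * (v x b).1 n)%N; first by exists (k + l)%N, b.
    have [K HK] := v2 x b a Ab ab 1%N; exists K => n /HK; nia.
  - exists (fun n => (k + l) * (v x a).1 n)%N; first by exists (k + l)%N, a.
    by exists 0%N => n _; rewrite mulnDl.
have unb x a : A a -> forall i, exists k, forall n, (k <= n)%N -> (i <= 1 * (v x a).1 n)%N.
  move=> Aa i; have [_ d] := v1 x a Aa; have [K HK] := d i.
  by exists K => n /HK; rewrite muln1 mul1n.
have Lv x a : A a -> L x (fun n => 1 * (v x a).1 n)%N by move=> Aa; exists 1%N, a.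
(* Where [y] goes up and [x] down, the lower end of [y] dominates the whole cut of [x]; a series
   having it as order separates the two primes. *)
have lt_cut x y a : A a -> (forall b, strict r b a -> x b <-> y b) -> ~ x a -> y a ->
    cut_ideal N U (L y) `<=` cut_ideal N U (L x) /\ cut_ideal N U (L y) <> cut_ideal N U (L x).
  move=> Aa xy nx ya; have dom := v3 x y a Aa xy nx ya.
  have U0 : ~ U set0 by exact: filter_not_empty.
  split=> [f Cf _ [k [b [Ab ->]]]|e].
    have := Cf _ (Lv y a Aa); have [K HK] := dom b Ab k => Ua.
    have UK : U [set n | (K <= n)%N] by apply: Ufree; exists K.
    apply: filterS (filterI Ua UK) => n /= [fn Kn] i ile; apply: fn.
    by apply: (leq_trans ile); rewrite mul1n; apply: leq_trans (HK n Kn); nia.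
  have [nd _] := v1 y a Aa.
  have [|f fP] := @series_of_order _ N p Np (v y a).1 nd.
    move=> k; have [K HK] := unb y a Aa k.+1.
    by exists K; have := HK K (leqnn _); rewrite mul1n.
  have : cut_ideal N U (L x) f.
    move=> _ [k [b [Ab ->]]]; have [K HK] := dom b Ab k.+1; apply: Ufree; exists K => // n /= Kn.
    by move=> i ile; apply/fP; apply: (leq_ltn_trans ile); apply: leq_trans (HK n Kn); nia.
  rewrite -e => /(_ _ (Lv y a Aa)); apply: contra_not U0; apply: filterS => n /=.
  by move=> /(_ ((v y a).1 n)); rewrite mul1n leqnn => /(_ isT) /fP; rewrite ltnn.
(* Sets of indices become branches through [h]; two of them part at the least point where their
   images differ. *)
have diff (x y : set (option aleph1)) : x <> y -> exists a, [/\ A a,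
   (forall b, strict r b a -> (h @` x) b <-> (h @` y) b) &
   (~ (h @` x) a /\ (h @` y) a) \/ (~ (h @` y) a /\ (h @` x) a)].
  move=> xy; pose D : set (set nat) := [set a | ~ ((h @` x) a <-> (h @` y) a)].
  have Dne : D !=set0.
    apply: contrapT => nD; apply: xy; apply/seteqP; split=> u xu.
      have : (h @` y) (h u).
        have : ((h @` x) (h u) <-> (h @` y) (h u)).
          by apply: contrapT => nxy; apply: nD; exists (h u).
        by move=> <-; exists u.
      by move=> [w yw /hinj <-].
    have : (h @` x) (h u).
      have : ((h @` x) (h u) <-> (h @` y) (h u)).
        by apply: contrapT => nxy; apply: nD; exists (h u).
      by move=> ->; exists u.
    by move=> [w yw /hinj <-].
  have [a Da amin] := wo_min rwo Dne; exists a; split.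
  - apply: contrapT => nA; apply: Da.
    by split=> -[u _ e]; case: nA; rewrite -e; apply: hA.
  - by move=> b ba; apply: contrapT => /amin /(strictP rwo).
  have [xa|nxa] := pselect ((h @` x) a); have [ya|nya] := pselect ((h @` y) a);
    [by case: Da|by right|by left|by case: Da].
exists (fun x => cut_ideal N U (L (h @` x))); split=> //.
- move=> x y e; apply: contrapT => /diff[a [Aa agree [[nx hy]|[ny hx]]]].
    by case: (lt_cut _ _ a Aa agree nx hy) => _; rewrite e.
  have agree' b : strict r b a -> (h @` y) b <-> (h @` x) b by move=> /agree ->.
  by case: (lt_cut _ _ a Aa agree' ny hx) => _; rewrite e.
- move=> x y; have [->|/eqP/diff[a [Aa agree [[nx hy]|[ny hx]]]]] := eqVneq x y; first by left.
    by right; case: (lt_cut _ _ a Aa agree nx hy).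
  have agree' b : strict r b a -> (h @` y) b <-> (h @` x) b by move=> /agree ->.
  by left; case: (lt_cut _ _ a Aa agree' ny hx).
- by move=> x; apply: cut_ideal_extended.
- move=> x; apply: (cut_ideal_series Nprime Uultra Ufree hM MN).
  by exists (fun n => 1 * (v (h @` x) (h None)).1 n)%N; [apply: Lv | apply: unb].
Qed.

(** * Bezout domains with radical factorizations *)

Lemma exists_maximal_ideal (R : comNzRingType) (I : set R) :
  proper_ideal I -> exists2 M, maximal_ideal M & I `<=` M.
Proof.
move=> hI.
have [F FP Ftot|M [[M0|[hM IM]] Mmax]] :=
    @Zorn_bigcup R [set J | J = set0 \/ (proper_ideal J /\ I `<=` J)].
- have [[J0 FJ0 J0ne]|allempty] := pselect (exists2 J, F J & J !=set0); last first.
    left; apply/seteqP; split=> // x [J FJ Jx].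
    by apply: allempty; exists J => //; exists x.
  have Fprop J x : F J -> J x -> proper_ideal J /\ I `<=` J.
    by move=> FJ Jx; case: (FP _ FJ) => // Je; rewrite Je in Jx.
  have [x0 J0x] := J0ne; have [hJ0 IJ0] := Fprop _ _ FJ0 J0x.
  right; split; last by move=> x /IJ0 Jx; exists J0.
  split; last by move=> [J FJ J1]; have [[_ nJ1] _] := Fprop _ _ FJ J1.
  split.
  + by exists J0 => //; case: hJ0 => -[].
  + move=> x y [J FJ Jx] [K FK Ky]; have [[[_ JD _] _] _] := Fprop _ _ FJ Jx.
    have [[[_ KD _] _] _] := Fprop _ _ FK Ky.
    have [JK|KJ] := Ftot _ _ FJ FK; first by exists K => //; apply: KD => //; apply: JK.
    by exists J => //; apply: JD => //; apply: KJ.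
  + move=> a x [J FJ Jx]; have [[[_ _ JM] _] _] := Fprop _ _ FJ Jx.
    by exists J => //; apply: JM.
- case: (Mmax I); last by right; split.
  rewrite M0; split=> // I0; case: hI => -[I00 _ _] _.
  exact: (I0 0 I00).
exists M => //; split=> // J hJ MJ; apply/seteqP; split=> //.
apply: contrapT => nJM; apply: (Mmax J); first by split.
by right; split=> //; apply: subset_trans MJ.
Qed.

Section Elements.
Variable R : idomainType.
Implicit Types (a b c d f g r s x y : R) (I J P Q M : set R).

Definition dvd a b : Prop := exists c, b = c * a.

Definition radical_elt r : Prop := forall s k, dvd r (s ^+ k) -> dvd r s.

Definition comaximal a b : Prop := exists u v, u * a + v * b = 1.

Lemma dvd_trans a b c : dvd a b -> dvd b c -> dvd a c.
Proof. by move=> [u ->] [v ->]; exists (v * u); rewrite mulrA. Qed.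

Lemma dvd_mull a b c : dvd a b -> dvd a (c * b).
Proof. by move=> [u ->]; exists (c * u); rewrite mulrA. Qed.

Lemma dvdD a b c : dvd a b -> dvd a c -> dvd a (b + c).
Proof. by move=> [u ->] [v ->]; exists (u + v); rewrite mulrDl. Qed.

Lemma dvd_refl a : dvd a a. Proof. by exists 1; rewrite mul1r. Qed.

Lemma dvd1_unit a : dvd a 1 -> a \is a GRing.unit.
Proof. by move=> [c e]; apply/unitrPr; exists c; rewrite mulrC -e. Qed.

Lemma dvd_ideal I a b : ideal I -> I a -> dvd a b -> I b.
Proof. by move=> [_ _ IM] Ia [c ->]; apply: IM. Qed.

Lemma ideal1 I : ideal I -> I 1 -> I = setT.
Proof. by move=> [_ _ IM] I1; apply/seteqP; split=> // x _; rewrite -[x]mulr1; apply: IM. Qed.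

Lemma principal_ideal a : ideal (dvd a).
Proof.
split; first by exists 0; rewrite mul0r.
  by move=> x y; exact: dvdD.
by move=> c x; exact: dvd_mull.
Qed.

Lemma ideal_mul_subr I J : ideal I -> ideal_mul I J `<=` I.
Proof.
move=> hI; apply: smallest_sub => // _ [x Ix [y _ <-]].
by rewrite mulrC; case: hI => _ _; apply.
Qed.

Lemma ideal_mulT I : ideal I -> ideal_mul I setT = I.
Proof.
move=> hI; apply/seteqP; split; first exact: ideal_mul_subr.
by move=> x Ix J [_]; apply; exists x => //; exists 1; rewrite ?mulr1.
Qed.

Lemma ideal_exp I x m n : ideal I -> (m <= n)%N -> I (x ^+ m) -> I (x ^+ n).
Proof. by move=> [_ _ IM] /subnK <- Ix; rewrite exprD; apply: IM. Qed.

Definition ideal_radical I : set R := [set x | exists n, I (x ^+ n)].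

Lemma ideal_radicalP I : ideal I -> radical_ideal (ideal_radical I).
Proof.
move=> hI; have [I0 ID IM] := hI; split; last first.
  by move=> x n [m]; rewrite -exprM => h; exists (n * m)%N.
split.
- by exists 1%N; rewrite expr1.
- move=> x y [m Im] [n In]; exists (m + n)%N; rewrite exprDn; apply: ideal_sum => // i _.
  rewrite -mulr_natl; apply: (IM); have [ni|ni] := leqP n i.
    by apply: IM; apply: ideal_exp In.
  by rewrite mulrC; apply: IM; apply: ideal_exp Im => //; lia.
- by move=> c x [n In]; exists n; rewrite exprMn; apply: IM.
Qed.

Lemma finite_product_cons (C : set R -> Prop) I J :
  C I -> finite_product_of C J -> finite_product_of C (ideal_mul I J).
Proof.
move=> CI [n [K [CK ->]]].
exists n.+1, (fun i => if unlift ord0 i is Some j then K j else I); split.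
  by move=> i; case: unliftP.
rewrite big_ord_recl unlift_none; congr ideal_mul.
by apply: eq_bigr => i _; rewrite liftK.
Qed.

(** * Factorization and maximal ideals in a Bezout domain *)

Section Bezout.
Hypothesis nontrivial : exists2 a : R, a != 0 & a \isn't a GRing.unit.
Hypothesis bezout : forall a b, exists d u v,
  [/\ dvd d a, dvd d b & d = u * a + v * b].
Hypothesis radical : forall f, f != 0 -> exists r k,
  [/\ radical_elt r, dvd r f & dvd f (r ^+ k)].
Hypothesis splitting : forall a, a != 0 -> a \isn't a GRing.unit ->
  exists b c, [/\ b \isn't a GRing.unit, c \isn't a GRing.unit, dvd b a, dvd c a &
    comaximal b c].
(** An ideal that contains [a] contains [x] if and only if it contains the associated [E n], so it
    is determined by a subset of nat. *)
Hypothesis countable_divisors : forall a, a != 0 ->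
  exists E : nat -> R, forall x, exists n u v, E n = u * x + v * a /\ dvd (E n) x.

(** An irreducible [p] would divide both of its comaximal nonunit divisors, hence 1. *)
Lemma no_irreducible : ~ exists p : R, irreducible p.
Proof.
move=> [p [p0 pu pirr]]; have [b [c [bu cu [b' bp] [c' cp] [u [v bc]]]]] := splitting p0 pu.
have pdvd x y : p = x * y -> y \isn't a GRing.unit -> dvd p y.
  move=> e yu; have [xu|] := pirr _ _ e; last by rewrite (negPf yu).
  by exists x^-1; rewrite e mulKr.
move/negP: pu; apply; apply: dvd1_unit; rewrite -bc; apply: dvdD; apply: dvd_mull.
  exact: pdvd bp bu.
exact: pdvd cp cu.
Qed.

(** If [g] generated [P], a nonunit divisor of [g] would lie in [P], since its cofactor cannot be a
    multiple of [g]. Two comaximal ones put 1 in [P]. *)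
Lemma prime_not_principal P g :
  prime_ideal P -> P g -> g != 0 -> ~ (forall x, P x -> dvd g x).
Proof.
move=> [[hP P1] Pprime] Pg g0 gP; have [P0 PD PM] := hP.
have gu : g \isn't a GRing.unit.
  by apply/negP => /divrr e; apply: P1; rewrite -e mulrC; apply: PM.
have [b [c [bu cu bg cg [u [v bc]]]]] := splitting g0 gu.
have Pdvd x : x \isn't a GRing.unit -> dvd x g -> P x.
  move=> xu [y e]; have Pyx : P (y * x) by rewrite -e.
  case: (Pprime _ _ Pyx) => // /gP [t yt].
  have y0 : y != 0 by apply: contraNneq g0 => y0; rewrite e y0 mul0r.
  case/negP: xu; apply: dvd1_unit; exists t; apply: (mulfI y0).
  by rewrite mulr1 {1}yt e; ring.
by apply: P1; rewrite -bc; apply: PD; apply: PM; apply: Pdvd.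
Qed.

Lemma ideal_gcd I x y : ideal I -> I x -> I y -> exists2 d, I d & dvd d x /\ dvd d y.
Proof.
move=> [_ ID IM] Ix Iy; have [d [u [v [dx dy e]]]] := bezout x y.
by exists d => //; rewrite e; apply: ID; apply: IM.
Qed.

(** A prime factor [P] of a nonzero principal ideal is finitely generated, hence principal by
    Bezout, contrary to [prime_not_principal]. *)
Lemma not_Dedekind : ~ Dedekind_domain R.
Proof.
move=> ded; have [f f0 fu] := nontrivial.
have [|n [J [Jprime e]]] := ded (dvd f).
  by split; [exact: principal_ideal | move/dvd1_unit; apply/negP].
case: n => [|n] in J Jprime e *.
  by case/negP: fu; apply: dvd1_unit; rewrite e big_ord0.
rewrite big_ord_recl in e; set Q := \big[_/_]_(i < n) _ in e; set P := J ord0 in e.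
have hP : prime_ideal P by exact: Jprime.
have [[PI P1] _] := hP.
(* Gcds in [P] make [S] closed under sums, and [x * c] is in [S] with witness [x], as [f] divides
   [m * c] for [m] in [P]. Membership of [f] says that [g] divides all of [P]. *)
pose S : set R := [set z | exists2 g, P g & forall m, P m -> dvd (f * g) (z * m)].
have hS : ideal S.
  split.
  - by exists 0 => [|m _]; [case: PI|exists 0; rewrite !mul0r].
  - move=> x y [g Pg gx] [h Ph hy]; have [d Pd [[u eu] [v ev]]] := ideal_gcd PI Pg Ph.
    exists d => // m Pm; rewrite mulrDl; apply: dvdD.
      by apply: dvd_trans (gx m Pm); exists u; rewrite eu; ring.
    by apply: dvd_trans (hy m Pm); exists v; rewrite ev; ring.
  - by move=> c x [g Pg gx]; exists g => // m Pm; rewrite -mulrA; apply/dvd_mull/gx.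
have [g Pg gf] : S f.
  have : ideal_mul P Q f by rewrite -e; exact: dvd_refl.
  apply; split=> // _ [x Px [c Qc <-]]; exists x => // m Pm.
  have [t et] : dvd f (m * c) by rewrite e => I [_]; apply; exists m => //; exists c.
  by exists t; rewrite -mulrA [c * m]mulrC et; ring.
have gP m : P m -> dvd g m.
  by move=> /gf [t et]; exists t; apply: (mulfI f0); rewrite et; ring.
apply: (prime_not_principal hP Pg _ gP).
have : P f by apply: (@ideal_mul_subr _ Q PI); rewrite -e; exact: dvd_refl.
by move=> /gP [t et]; apply: contraNneq f0 => g0; rewrite et g0 mulr0.
Qed.

Local Notation tofrac := (@FracField.tofrac R).

(** The argument of [not_Dedekind] in the fraction field: 1 in P J gives one [g] in [P] that divides
    all of [P]. *)
Lemma prime_not_invertible P : prime_ideal P -> ~ invertible P.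
Proof.
move=> hP [J [hJ _] e]; have [[PI P1] _] := hP; have [P0 PD PM] := PI.
have JP x (y : {fraction R}) : P x -> J y -> exists z, y * tofrac x = tofrac z.
  move=> Px Jy; suff [z _ ez] : range tofrac (tofrac x * y) by exists z; rewrite mulrC ez.
  by rewrite -e => S [_]; apply; exists (tofrac x); [exists x|exists y].
pose S : set {fraction R} := [set z | exists2 g, P g &
  forall m, P m -> exists t, z * tofrac m = tofrac (t * g)].
have : fractional_mul [set tofrac x | x in P] J 1 by rewrite e; exists 1; rewrite ?rmorph1.
case/(_ S) => [|g Pg gP].
  split; last first.
    move=> _ [_ [x Px <-] [y Jy <-]]; exists x => // m Pm; have [t et] := JP m y Pm Jy.
    by exists t; rewrite -mulrA et rmorphM mulrC.
  split.
  - by exists 0 => // m _; exists 0; rewrite !mul0r rmorph0.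
  - move=> x y [g Pg gx] [h Ph hy]; have [d Pd [[u eu] [v ev]]] := ideal_gcd PI Pg Ph.
    exists d => // m Pm; have [s es] := gx m Pm; have [t et] := hy m Pm.
    exists (s * u + t * v); rewrite mulrDl es et -rmorphD; congr (tofrac _).
    by rewrite eu ev; ring.
  - move=> c x [g Pg gx]; exists g => // m Pm; have [s es] := gx m Pm.
    by exists (c * s); rewrite -mulrA es -rmorphM mulrA.
have {}gP m : P m -> dvd g m.
  by move=> /gP [t]; rewrite mul1r => /eqP; rewrite tofrac_eq => /eqP ->; exists t.
apply: (prime_not_principal hP Pg _ gP); apply/eqP => g0.
(* If [g] were 0, then [P] and P J would be 0. *)
have : fractional_mul [set tofrac x | x in P] J 1 by rewrite e; exists 1; rewrite ?rmorph1.
pose Z : set {fraction R} := [set 0].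
move=> /(_ Z) Z1;
suff /Z1/eqP : submodule Z /\
    [set x * y | x in [set tofrac x | x in P] & y in J] `<=` Z.
  by rewrite oner_eq0.
split.
  by split=> [//|x y -> ->|a x ->]; rewrite ?addr0 ?mulr0.
move=> _ [_ [x /gP[t ->] <-] [y _ <-]] /=.
by rewrite g0 mulr0 rmorph0 mul0r.
Qed.

(** Let [d] be a gcd of [g] and [h ^+ n], and g = d' d. A power of h d' is a multiple of [g], hence
    of [g1]; so [g1] divides h d', and cancelling [g1] shows that [d] divides [w * h]. *)
Lemma colon_radical I g g1 w h n : ideal I -> radical_elt g1 -> g = w * g1 -> g != 0 ->
  I g -> I (h ^+ n) -> I (w * h).
Proof.
move=> hI rg1 gw g0 Ig; have [I0 ID IM] := hI.
case: n => [|n] Ih; first by rewrite (ideal1 hI Ih).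
have [d Id [[d' ed'] [e he]]] := ideal_gcd hI Ig Ih.
have [t et] : dvd g1 (h * d').
  apply: (rg1 _ n.+1); exists (e * w * d' ^+ n).
  rewrite exprMn he [d' ^+ n.+1]exprS -mulrA.
  transitivity (e * d' ^+ n * g); [rewrite ed'; ring|rewrite gw; ring].
have g10 : g1 != 0 by apply: contraNneq g0 => g10; rewrite gw g10 mulr0.
apply: (dvd_ideal hI Id); exists t; apply: (mulfI g10).
transitivity (g * h); first by rewrite gw; ring.
by rewrite ed'; transitivity ((h * d') * d); [ring|rewrite et; ring].
Qed.

Lemma SP_of_radical_power r k I : ideal I -> radical_elt r -> r != 0 -> I (r ^+ k) ->
  finite_product_of (@radical_ideal R) I.
Proof.
move=> + rr r0; elim: k I => [|k IH] I hI Ir.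
  exists 0%N, (fun=> setT); split=> [i|]; last by rewrite big_ord0; exact: ideal1 hI Ir.
  by split=> //; split.
have [I0 ID IM] := hI; have hN := ideal_radicalP hI.
pose I' : set R := [set y | forall x, ideal_radical I x -> I (y * x)].
have hI' : ideal I'.
  split=> [x _|x y Ix Iy z Nz|c x Ix z Nz]; first by rewrite mul0r.
    by rewrite mulrDl; apply: ID; [exact: Ix|exact: Iy].
  by rewrite -mulrA; apply/IM/Ix.
(* A nonzero [g] in [I] is [w * g1] with [g1] a radical divisor; [g1] lies in the radical of [I],
   and [w] in the colon ideal by [colon_radical]. *)
have -> : I = ideal_mul (ideal_radical I) I'.
  apply/seteqP; split; last first.
    apply: smallest_sub => // _ [x Nx [y I'y <-]]; rewrite mulrC; exact: I'y.
  move=> g Ig; have [->|g0] := eqVneq g 0;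
    first by case: (ideal_smallest [set x * y | x in ideal_radical I & y in I']).
  have [g1 [m [rg1 [w gw] gm]]] := radical g0.
  move=> J [_]; apply; exists g1; first by exists m; exact: dvd_ideal gm.
  exists w; last by rewrite gw mulrC.
  by move=> h [n In]; exact: (colon_radical hI rg1 gw g0 Ig In).
(* [colon_radical] with [g = r ^+ k.+1] and [g1 = r] puts [r ^+ k] in the colon ideal. *)
apply: finite_product_cons => //; apply: IH => // h [n In].
apply: (@colon_radical I (r ^+ k.+1) r _ h n) => //; first by rewrite exprSr.
by rewrite expf_neq0.
Qed.

Lemma SP_domain_of_bezout : SP_domain R.
Proof.
move=> I [hI I1]; have [[f If f0]|nf] := pselect (exists2 f, I f & f != 0).
  have [r [k [rr rf fr]]] := radical f0.
  apply: (@SP_of_radical_power r k) => //; last exact: dvd_ideal fr.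
  by have [t et] := rf; apply: contraNneq f0 => r0; rewrite et r0 mulr0.
have I0 x : I x -> x = 0 by move=> Ix; apply: contrapT => /eqP x0; apply: nf; exists x.
exists 1%N, (fun=> I); split; last by rewrite big_ord_recl big_ord0 ideal_mulT.
move=> _; split=> // x n /I0 /eqP; rewrite expf_eq0 => /andP[_ /eqP ->].
by case: hI.
Qed.

(** Upper bound: [M] is determined by the [n] with [E n] in [M]. Lower bound: a subset of nat
    selects a path of successive divisors of [a]; at the first difference of two paths the divisors
    are comaximal, so no maximal ideal contains both paths. *)
Lemma card_maximal_ideals a : a != 0 -> a \isn't a GRing.unit ->
  [set M : set R | maximal_ideal M /\ M a] #= [set: set nat].
Proof.
move=> a0 au; apply: Cantor_Bernstein.
  have [E HE] := countable_divisors a0.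
  pose F (M : set R) : set nat := [set n | M (E n)].
  have Finj : {in [set M : set R | maximal_ideal M /\ M a] &, injective F}.
    move=> M M'; rewrite !inE => -[[[hM _] _] Ma] [[[hM' _] _] Ma'] e.
    have sub (K K' : set R) : ideal K -> ideal K' -> K a -> F K = F K' -> K `<=` K'.
      move=> [K0 KD KM] hK' Ka eF x Kx; have [n [u [v [En nx]]]] := HE x.
      apply: (dvd_ideal hK') nx; suff : F K' n by [].
      by rewrite -eF /F /= En; apply: KD; apply: KM.
    by apply/seteqP; split; apply: sub.
  rewrite -(card_le_eql (inj_card_eq Finj)); exact: card_leT.
have /choice[sp spP] : forall x : R, exists bc : R * R, x != 0 -> x \isn't a GRing.unit ->
    [/\ bc.1 \isn't a GRing.unit, bc.2 \isn't a GRing.unit, dvd bc.1 x, dvd bc.2 x &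
       comaximal bc.1 bc.2].
  move=> x; have [[x0 xu]|nx] := pselect (x != 0 /\ x \isn't a GRing.unit).
    by have [b [c H]] := splitting x0 xu; exists (b, c).
  by exists (0, 0) => x0 xu; case: nx.
pose t (X : set nat) := fix t n := if n is n'.+1 then
   if `[< X n' >] then (sp (t n')).1 else (sp (t n')).2 else a.
have tP X n : t X n != 0 /\ t X n \isn't a GRing.unit.
  elim: n => [//|n [t0 tu]] /=; have [h1 h2 h3 h4 _] := spP _ t0 tu.
  have nz x : dvd x (t X n) -> x != 0.
    by move=> [y e]; apply: contraNneq t0 => x0; rewrite e x0 mulr0.
  by case: ifP => _; split=> //; apply: nz.
have tS X n : dvd (t X n.+1) (t X n).
  have [t0 tu] := tP X n; have [h1 h2 h3 h4 _] := spP _ t0 tu.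
  by rewrite /=; case: ifP.
have tle X m n : (m <= n)%N -> dvd (t X n) (t X m).
  move=> /subnK <-; elim: (n - m)%N => [|k IH]; first exact: dvd_refl.
  by rewrite addSn; apply: dvd_trans IH.
have /choice[MX MXP] : forall X : set nat, exists M : set R,
    maximal_ideal M /\ forall n, M (t X n).
  move=> X; have [|M hM IM] := @exists_maximal_ideal R [set y | exists n, dvd (t X n) y].
    split; last by move=> [n /dvd1_unit]; apply/negP; case: (tP X n).
    split; first by exists 0%N, 0; rewrite mul0r.
      move=> x y [m mx] [n ny]; exists (maxn m n); apply: dvdD.
        by apply: dvd_trans mx; apply: tle; exact: leq_maxl.
      by apply: dvd_trans ny; apply: tle; exact: leq_maxr.
    by move=> c x [n nx]; exists n; apply: dvd_mull.
  by exists M; split=> // n; apply: IM; exists n; exact: dvd_refl.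
have tagree X Y n : (forall k, (k < n)%N -> X k <-> Y k) -> t X n = t Y n.
  elim: n => [//|n IH] XY /=; rewrite IH => [|k kn]; last by apply: XY; exact: ltnW.
  by rewrite (propext (XY n (ltnSn n))).
apply: (@card_le_inj _ _ MX); last by move=> X; case: (MXP X) => hM Mt; split=> //; exact: (Mt 0%N).
move=> X Y eM; apply: contrapT => XY.
have [n [nXY nmin]] : exists n, ~ (X n <-> Y n) /\ forall k, (k < n)%N -> X k <-> Y k.
  have ex : exists n, ~~ `[< X n <-> Y n >].
    apply: contrapT => nex; apply: XY; apply/seteqP; split=> n.
      by have : X n <-> Y n by [apply: contrapT => h; apply: nex; exists n; apply/asboolP]; move=> [].
    by have : X n <-> Y n by [apply: contrapT => h; apply: nex; exists n; apply/asboolP]; move=> [].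
  have [n /asboolP nn nmin] := ex_minnP ex; exists n; split=> // k kn.
  by apply: contrapT => h; move: kn; rewrite ltnNge nmin //; apply/asboolP.
have [[[[M0 MD MM] M1] Mmax] MtX] := MXP X; have [_ MtY] := MXP Y; rewrite -eM in MtY.
have [t0 tu] := tP X n; have [_ _ _ _ [u [v uv]]] := spP _ t0 tu.
have := MtX n.+1; have := MtY n.+1; rewrite /= -(tagree X Y n nmin).
have [Xn|nXn] := pselect (X n); have [Yn|nYn] := pselect (Y n).
- by case: nXY.
- rewrite (asboolT Xn) (asboolF nYn) => h2 h1; apply: M1.
  by rewrite -uv; apply: MD; apply: MM.
- rewrite (asboolF nXn) (asboolT Yn) => h1 h2; apply: M1.
  by rewrite -uv; apply: MD; apply: MM.
- by case: nXY.
Qed.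

Lemma maximal_ne0 M : maximal_ideal M -> exists2 a, M a & a != 0.
Proof.
move=> [[hM M1] Mmax]; apply: contrapT => nM; have [f f0 fu] := nontrivial.
have e : dvd f = M.
  apply: Mmax; first by split; [exact: principal_ideal | move/dvd1_unit; apply/negP].
  move=> x Mx; have -> : x = 0 by apply: contrapT => /eqP x0; apply: nM; exists x.
  by case: (principal_ideal f).
by apply: nM; exists f => //; rewrite -e; exact: dvd_refl.
Qed.

Lemma maximal_separating_family M : maximal_ideal M ->
  exists (N : nat -> set R) (p : nat -> R), [/\ forall n, prime_ideal (N n),
    forall n k, N n (p k) <-> (k <= n)%N &
    forall a, M a -> exists k, forall n, (k <= n)%N -> N n a].
Proof.
move=> hM; have hMp := maximal_prime hM; have [[MI M1] Mprime] := hMp.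
have Mexp x k : M (x ^+ k) -> M x.
  elim: k => [|k IH]; first by rewrite expr0.
  by rewrite exprS => /Mprime[//|].
have [a Ma a0] := maximal_ne0 hM; have [E HE] := countable_divisors a0.
(* [M] is not principal, so a gcd of [q] with some element of [M] is a proper divisor. Taking a gcd
   with [E n] as well, then a radical divisor, stays in [M], a power of the latter being in [M]. *)
have /choice[next nextP] : forall qn : R * nat, exists q', M qn.1 -> qn.1 != 0 ->
    [/\ M q', q' != 0, radical_elt q', dvd q' qn.1 &
      ~ dvd qn.1 q' /\ (M (E qn.2) -> dvd q' (E qn.2))].
  move=> [q n] /=; have [[Mq q0]|nq] := pselect (M q /\ q != 0);
    last by exists 0 => Mq q0; case: nq.
  have [m Mm qm] : exists2 m, M m & ~ dvd q m.
    apply: contrapT => nm; apply: (prime_not_principal hMp Mq q0) => x Mx.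
    by apply: contrapT => qx; apply: nm; exists x.
  have [d Md [dq dm]] := ideal_gcd MI Mq Mm.
  have [d' [Md' d'd d'E]] : exists d', [/\ M d', dvd d' d & M (E n) -> dvd d' (E n)].
    have [ME|nME] := pselect (M (E n)).
      by have [d' Md' [h1 h2]] := ideal_gcd MI Md ME; exists d'.
    by exists d; split=> //; exact: dvd_refl.
  have d'0 : d' != 0.
    have [t et] := dvd_trans d'd dq.
    by apply: contraNneq q0 => d'0; rewrite et d'0 mulr0.
  have [r [k [rr rd' d'r]]] := radical d'0.
  exists r => _ _; split=> //.
  - exact: Mexp (dvd_ideal MI Md' d'r).
  - by have [t et] := rd'; apply: contraNneq d'0 => r0; rewrite et r0 mulr0.
  - exact: dvd_trans (dvd_trans rd' d'd) dq.
  split; last by move=> /d'E; exact: dvd_trans.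
  by move=> qr; apply: qm; exact: dvd_trans (dvd_trans qr rd') (dvd_trans d'd dm).
pose q := fix q n := if n is n'.+1 then next (q n', n') else a.
have qP n : M (q n) /\ q n != 0.
  elim: n => [//|n [Mq q0]] /=; have [] := nextP (q n, n) Mq q0; by [].
have qS n : [/\ radical_elt (q n.+1), dvd (q n.+1) (q n), ~ dvd (q n) (q n.+1) &
    M (E n) -> dvd (q n.+1) (E n)].
  by have [Mq q0] := qP n; have [_ _ h1 h2 [h3 h4]] := nextP (q n, n) Mq q0.
(* As [q n.+1] is radical, its nonunit cofactor [s] over [q n.+2] is coprime to [q n.+2]; a maximal
   ideal containing [s] avoids [q n.+2]. *)
have /choice[N NP] : forall n, exists N : set R,
    [/\ maximal_ideal N, N (q n.+1) & ~ N (q n.+2)].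
  move=> n; have [rq _ _ _] := qS n; have [_ [s es] nd _] := qS n.+1; have [_ q0] := qP n.+1.
  have su : s \isn't a GRing.unit.
    by apply/negP => su; apply: nd; exists s^-1; rewrite es mulKr.
  have [|N hN sN] := @exists_maximal_ideal R (dvd s).
    by split; [exact: principal_ideal | move/dvd1_unit; apply/negP].
  have [[NI N1] _] := hN; have Ns : N s by apply: sN; exact: dvd_refl.
  exists N; split=> // [|Nq].
    by apply: (dvd_ideal NI Ns); exists (q n.+2); rewrite es mulrC.
  (* Here q_(n+1) = e^2 s' q' is radical, so it divides e s' q', and [e] is a unit lying in [N]. *)
  have [e Ne [[s' es'] [q' eq']]] := ideal_gcd NI Ns Nq.
  have key : q n.+1 = (s' * e) * (q' * e) by rewrite es -es' -eq'.
  have [t et] : dvd (q n.+1) (e * (s' * q')).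
    apply: (rq _ 2%N); exists (s' * q'); rewrite key; ring.
  apply: N1; apply: (dvd_ideal NI Ne); exists t.
  have e0 : e * (s' * q') != 0.
    apply: contraNneq q0 => h; apply/eqP; rewrite key.
    by transitivity (e * (e * (s' * q'))); [ring|rewrite h mulr0].
  by apply: (mulfI e0); rewrite mulr1 {1}et key; ring.
have qle m n : (m <= n)%N -> dvd (q n) (q m).
  move=> /subnK <-; elim: (n - m)%N => [|k IH]; first exact: dvd_refl.
  by rewrite addSn; apply: dvd_trans IH; case: (qS (k + m)%N).
have Nideal n : ideal (N n) by case: (NP n) => -[[]].
have Nmono n k : (k <= n)%N -> N n (q k.+1).
  by move=> kn; apply: (dvd_ideal (Nideal n)) (qle k.+1 n.+1 kn); case: (NP n).
(* The shift skips [q 0 = a], which may fail to be radical. *)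
exists N, (fun k => q k.+1); split.
- by move=> n; case: (NP n) => hN _ _; exact: maximal_prime.
- move=> n k; split=> [Nq|]; last exact: Nmono.
  rewrite leqNgt; apply/negP => nk; have [_ _] := NP n; apply.
  by apply: (dvd_ideal (Nideal n) Nq); exact: qle.
move=> x Mx; have [n [u [v [En nx]]]] := HE x.
have ME : M (E n) by have [_ MD MM] := MI; rewrite En; apply: MD; apply: MM.
exists n => m nm; apply: (dvd_ideal (Nideal m) (Nmono m n nm)).
by apply: dvd_trans nx; case: (qS n) => _ _ _; apply.
Qed.

End Bezout.
End Elements.

(** * Radical polynomials and the substitution of a power of X *)

Section Polynomials.
Variable F : fieldType.
Implicit Types p q r s g : {poly F}.

(** For nonzero [r] this is square-freeness. *)
Definition radical_poly r : Prop := forall s k, r %| s ^+ k -> r %| s.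

Lemma exists_min_size (P : {poly F} -> Prop) p0 : P p0 ->
  exists2 p, P p & forall q, P q -> (size p <= size q)%N.
Proof.
move=> Pp0; have ex : exists n, `[< exists2 p, P p & size p = n >].
  by exists (size p0); apply/asboolP; exists p0.
have [n /asboolP[p Pp <-] nmin] := ex_minnP ex; exists p => // q Pq.
by apply: nmin; apply/asboolP; exists q.
Qed.

(** Among the divisors of [p] with a power divisible by [p], one of least size is radical: if it
    divides a power of [s], its gcd with [s] is again such a divisor. *)
Lemma radical_poly_exists p : p != 0 ->
  exists r k, [/\ radical_poly r, r %| p & p %| r ^+ k].
Proof.
move=> p0; have [|r [rp [k pr]] rmin] :=
  @exists_min_size (fun r => r %| p /\ exists k, p %| r ^+ k) p.
  by split; [exact: dvdpp | exists 1%N; rewrite expr1 dvdpp].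
exists r, k; split=> // s j rs.
have r0 : r != 0 by apply: contraNneq p0 => r0; move: rp; rewrite r0 dvd0p.
have [[u v] /= uv] := Bezoutp r s; set g := gcdp r s in uv.
have gr : g %| r by exact: dvdp_gcdl.
have rgj : r %| g ^+ j.
  rewrite -(eqp_dvdr _ (eqp_exp j uv)) -[_ ^+ j](subrK ((v * s) ^+ j)) dvdp_addr.
    by rewrite exprMn; apply: dvdp_mull.
  by rewrite subrXX addrK; apply/dvdp_mulr/dvdp_mull/dvdpp.
have : (size r <= size g)%N.
  apply: rmin; split; first exact: dvdp_trans rp.
  exists (j * k)%N; rewrite exprM; apply: dvdp_trans pr _; exact: dvdp_exp2r.
move=> rg; have : g %= r by rewrite -dvdp_size_eqp // eqn_leq rg dvdp_leq.
by move/eqp_dvdl <-; exact: dvdp_gcdr.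
Qed.

Lemma ltn_size_mul p q : p != 0 -> (1 < size q)%N -> (size p < size (p * q)%R)%N.
Proof.
move=> p0 q1; have q0 : q != 0 by rewrite -size_poly_gt0 ltnW.
have -> : size (p * q) = (size p + size q).-1 by exact: size_mul.
by move: p0; rewrite -size_poly_gt0; lia.
Qed.

Lemma irreducible_factor p : (1 < size p)%N ->
  exists2 q : {poly F}, irreducible_poly q & q %| p.
Proof.
move=> p1; have [|q [q1 qp] qmin] :=
    @exists_min_size (fun q => (1 < size q)%N /\ q %| p) p.
  by split.
exists q => //; split=> // d d1 dq.
have q0 : q != 0 by rewrite -size_poly_gt0 ltnW.
rewrite -dvdp_size_eqp // eqn_leq dvdp_leq //=; apply: qmin; split; last exact: dvdp_trans qp.
rewrite ltn_neqAle eq_sym d1 size_poly_gt0; apply: contraNneq q0 => d0.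
by move: dq; rewrite d0 dvd0p.
Qed.

Lemma irreducible_radical q : irreducible_poly q -> radical_poly q.
Proof.
move=> [q1 qdiv] s k qs; have [cqs|ncqs] := boolP (coprimep q s).
  by move: qs q1; rewrite -[s ^+ k]mul1r Gauss_dvdpl ?coprimep_expr // dvdp1 => /eqP ->.
by rewrite -(eqp_dvdl _ (qdiv _ ncqs (dvdp_gcdl _ _))); exact: dvdp_gcdr.
Qed.

Lemma finite_divisors p : p != 0 ->
  exists s : seq {poly F}, forall d, d %| p -> exists2 e, e \in s & d %= e.
Proof.
elim: (size p) {-2}p (leqnn (size p)) => [|n IH] {}p pn p0.
  by rewrite size_poly_leq0 in pn; rewrite (eqP pn) eqxx in p0.
have [p1|p1] := leqP (size p) 1.
  exists [:: 1] => d dp; exists 1; rewrite ?mem_head //.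
  by apply: dvdp_eqp1 dp _; rewrite -size_poly_eq1 eqn_leq p1 size_poly_gt0.
have [q [q1 qirr] /dvdpP[h ph]] := irreducible_factor p1.
have h0 : h != 0 by apply: contraNneq p0 => h0; rewrite ph h0 mul0r.
have q0 : q != 0 by apply: contraNneq p0 => q0; rewrite ph q0 mulr0.
have [|s hs] := IH h _ h0.
  by rewrite -ltnS (leq_trans _ pn) // ph ltn_size_mul.
exists (s ++ [seq e * q | e <- s]) => d; rewrite ph => dp.
have [qd|qd] := boolP (q %| d).
  have /dvdpP[d' ed'] := qd; move: dp; rewrite ed' dvdp_mul2r // => /hs[e es d'e].
  by exists (e * q); [rewrite mem_cat; apply/orP; right; apply/mapP; exists e | rewrite eqp_mul2r].
have : d %| h.
  rewrite -(@Gauss_dvdpl _ _ q) // coprimep_def; apply: contraR qd => g1.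
  by rewrite -(eqp_dvdl _ (qirr _ g1 (dvdp_gcdr _ _))); exact: dvdp_gcdl.
by move=> /hs[e es de]; exists e; rewrite // mem_cat es.
Qed.

Lemma radical_poly_coprime s t : s * t != 0 -> radical_poly (s * t) -> coprimep s t.
Proof.
move=> st0 rst; set g := gcdp s t.
have /dvdpP[s' es] : g %| s by exact: dvdp_gcdl.
have /dvdpP[t' et] : g %| t by exact: dvdp_gcdr.
have : s * t %| s' * g * t'.
  by apply: (rst _ 2%N); apply/dvdpP; exists (s' * t'); rewrite es et; ring.
have w0 : s' * g * t' != 0.
  by move: st0; rewrite es et; rewrite !mulf_eq0; case: (_ == 0); case: (_ == 0); case: (_ == 0).
move=> /(dvdp_leq w0).
have -> : s * t = (s' * g * t') * g by rewrite {1}es {1}et; ring.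
have g0 : g != 0 by apply: contraNneq w0 => ->; rewrite mulr0 mul0r.
rewrite size_mul // coprimep_def -/g; have := w0; rewrite -size_poly_gt0.
by have := g0; rewrite -size_poly_gt0; lia.
Qed.

Lemma size_comp_Xn p n : (0 < n)%N -> (size (p \Po 'X^n)).-1 = ((size p).-1 * n)%N.
Proof. by move=> n0; rewrite size_comp_poly size_polyXn. Qed.

Lemma comp_Xn_eq0 p n : (0 < n)%N -> (p \Po 'X^n == 0) = (p == 0).
Proof. by move=> n0; rewrite comp_poly_eq0 ?size_polyXn. Qed.

Lemma dvdp_comp p q r : p %| q -> p \Po r %| q \Po r.
Proof. by move=> /dvdpP[t ->]; rewrite comp_polyM dvdp_mull. Qed.

(** The remainder of [q] by [p], composed with X^2, is a multiple of p(X^2); by degrees it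
    vanishes. *)
Lemma dvdp_comp_X2 p q : p \Po 'X^2 %| q \Po 'X^2 -> p %| q.
Proof.
have [->|p0] := eqVneq p 0; first by rewrite comp_poly0 !dvd0p comp_Xn_eq0.
rewrite {1}(divp_eq q p) comp_polyD comp_polyM dvdp_addr ?dvdp_mull ?dvdpp //.
move=> pm; rewrite /dvdp; apply: contraTT (ltn_modpN0 q p0) => m0.
have m20 : (q %% p) \Po 'X^2 != 0 by rewrite comp_Xn_eq0.
rewrite -leqNgt; have h : (size (p \Po 'X^2) <= size ((q %% p)%R \Po 'X^2))%N := dvdp_leq m20 pm.
have h1 := @size_comp_Xn p 2 isT; have h2 := @size_comp_Xn (q %% p) 2 isT.
have h3 : (0 < size p)%N by rewrite size_poly_gt0.
have h4 : (0 < size (q %% p)%R)%N by rewrite size_poly_gt0.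
suff : (size p <= size (q %% p)%R)%N by [].
move: h h1 h2 h3 h4; move: (size p) (size (q %% p)) (size (p \Po 'X^2)) (size ((q %% p)%R \Po 'X^2)).
lia.
Qed.

Hypothesis char2 : 2%N \notin [pchar F].

(* With s = a(X^2) + X b(X^2), a power of s(X) and a power of s(-X) are divisible by
   r(X^2), hence so are powers of a(X^2) and of X b(X^2). *)
Lemma radical_poly_comp_X2 r : ~~ root r 0 -> radical_poly r -> radical_poly (r \Po 'X^2).
Proof.
move=> r0 rr s k rs; set R := r \Po 'X^2 in rs *.
set a := even_poly s; set b := odd_poly s.
have es : s = a \Po 'X^2 + (b \Po 'X^2) * 'X by rewrite poly_even_odd.
pose s' := s \Po - 'X.
have X2 : 'X^2 \Po - 'X = 'X^2 :> {poly F} by rewrite comp_Xn_poly sqrrN.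
have rs' : R %| s' ^+ k.
  have -> : s' ^+ k = (s ^+ k) \Po - 'X by rewrite rmorphXn.
  have -> : R = R \Po - 'X by rewrite /R -comp_polyA X2.
  exact: dvdp_comp.
have es' : s' = a \Po 'X^2 - (b \Po 'X^2) * 'X.
  by rewrite /s' es comp_polyD comp_polyM comp_polyX -!comp_polyA X2 mulrN.
have two : (2%:R : F) != 0.
  by apply: contra char2 => h; rewrite inE /= h.
have power x y : R %| x ^+ k -> R %| y ^+ k -> R %| (x + y) ^+ (k + k).
  move=> hx hy; rewrite exprDn; apply: (big_ind (fun u => R %| u)) => [|u v|i _].
  - exact: dvdp0.
  - exact: dvdp_add.
  rewrite -mulr_natl; apply: dvdp_mull; have [ki|ki] := leqP k i.
    by apply/dvdp_mull/(dvdp_trans hy)/dvdp_exp2l.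
  by apply/dvdp_mulr/(dvdp_trans hx)/dvdp_exp2l; lia.
have half x : R %| (x *+ 2) ^+ (k + k) -> R %| x ^+ (k + k).
  by rewrite -scaler_nat exprZn dvdpZr // expf_neq0.
have ra : r %| a.
  apply: (rr _ (k + k)%N); apply: dvdp_comp_X2; rewrite rmorphXn; apply: half.
  have -> : (a \Po 'X^2) *+ 2 = s + s' by rewrite es es'; ring.
  exact: power.
have rb : r %| b.
  have cX : coprimep r 'X by rewrite coprimepX.
  apply: (rr _ 2%N); rewrite -(@Gauss_dvdpl _ _ 'X) //.
  apply: (rr _ (k + k)%N); apply: dvdp_comp_X2.
  have -> : ((b ^+ 2 * 'X) ^+ (k + k)) \Po 'X^2 = (((b \Po 'X^2) * 'X) ^+ (k + k)) ^+ 2.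
    rewrite rmorphXn /= -[RHS]exprM mulnC [RHS]exprM; congr (_ ^+ _).
    by rewrite comp_polyM rmorphXn /= comp_polyX exprMn.
  rewrite expr2; apply: dvdp_mulr; apply: half.
  have -> : ((b \Po 'X^2) * 'X) *+ 2 = s + - s' by rewrite es es'; ring.
  by apply: power => //; rewrite exprNn dvdp_mull.
by rewrite es; apply: dvdp_add; [|apply: dvdp_mulr]; apply: dvdp_comp.
Qed.

(** Change of level: [p] at X^(1/2^n) equals [dilate k p] at X^(1/2^(k+n)). *)
Definition dilate k p := p \Po 'X^(2 ^ k).

Lemma dilate0 p : dilate 0 p = p. Proof. by rewrite /dilate comp_polyXr. Qed.

Lemma dilateS k p : dilate k.+1 p = dilate k p \Po 'X^2.
Proof. by rewrite /dilate -comp_polyA comp_Xn_poly -exprM -expnS. Qed.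

Lemma dilate_add k l p : dilate k (dilate l p) = dilate (k + l) p.
Proof. by elim: k => [|k IH]; rewrite ?dilate0 // addSn !dilateS IH. Qed.

Lemma dilate_root0 k p : root (dilate k p) 0 = root p 0.
Proof. by rewrite !rootE horner_comp hornerXn expr0n expn_eq0. Qed.

Lemma dilate_eq0 k p : (dilate k p == 0) = (p == 0).
Proof. by rewrite comp_Xn_eq0 // expn_gt0. Qed.

Lemma size_dilate k p : (size (dilate k p)).-1 = ((size p).-1 * 2 ^ k)%N.
Proof. by rewrite size_comp_Xn // expn_gt0. Qed.

Lemma dilate_radical k r : ~~ root r 0 -> radical_poly r -> radical_poly (dilate k r).
Proof.
move=> r0 rr; elim: k => [|k IH]; first by rewrite dilate0.
by rewrite dilateS; apply: radical_poly_comp_X2 => //; rewrite dilate_root0.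
Qed.

(** After [N] doublings of its degree an irreducible factor of [p] exceeds the size bound, so it has
    a proper factorization; being still radical, it has coprime factors. *)
Lemma dilate_splits (N : nat) p : (forall q : {poly F}, irreducible_poly q -> (size q <= N)%N) ->
  (1 < size p)%N -> ~~ root p 0 -> exists k (s t : {poly F}),
  [/\ (1 < size s)%N, (1 < size t)%N, s %| dilate k p, t %| dilate k p & coprimep s t].
Proof.
move=> HN p1 p0; have pn0 : p != 0 by rewrite -size_poly_gt0 ltnW.
have [q qirr qp] := irreducible_factor p1; have [q1 qdiv] := qirr.
have rq : radical_poly q by exact: irreducible_radical.
have q0 : ~~ root q 0 by apply: contra p0; have /dvdpP[t ->] := qp => q0; rewrite rootM q0 orbT.
have [szq l1] : (N < size (dilate N q))%N /\ (1 < size (dilate N q))%N.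
  have := size_dilate N q; have := ltn_expl N (isT : (1 < 2)%N).
  have : (1 < size q)%N by exact: q1.
  by move: (size (dilate N q)) (size q) (2 ^ N)%N => a b c; nia.
have [s sirr /dvdpP[t est]] := irreducible_factor l1.
have l0 : t * s != 0 by rewrite -est -size_poly_gt0 ltnW.
have [t0 s0] : t != 0 /\ s != 0 by move: l0; rewrite mulf_eq0 negb_or => /andP.
exists N, s, t; split.
- by case: sirr.
- rewrite ltnNge; apply/negP => t1.
  have sN : (size s <= N)%N := HN s sirr.
  by move: szq; rewrite est => /leq_trans /(_ (size_polyMleq t s)); lia.
- by apply: dvdp_trans (dvdp_comp _ qp); rewrite -/(dilate _ _) est dvdp_mulIr.
- by apply: dvdp_trans (dvdp_comp _ qp); rewrite -/(dilate _ _) est dvdp_mulIl.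
rewrite coprimep_sym; apply: radical_poly_coprime => //.
by rewrite -est; exact: dilate_radical.
Qed.

End Polynomials.

(** * Fields with a finite algebraic closure *)

Lemma closed_root_exp (K : fieldType) n (a : K) : GRing.closed_field_axiom K ->
  (0 < n)%N -> exists b : K, b ^+ n = a.
Proof.
move=> closedK n0; have [b] := closedK n (fun i => if i is 0 then a else 0) n0.
case: n n0 => // n _; rewrite big_ord_recl mulr1 big1 ?addr0; first by exists b.
by move=> i _; rewrite mul0r.
Qed.

(** * Automorphisms of an algebraically closed field of characteristic 2 *)

Section ArtinSchreier.
Variables (F : fieldType) (K : splittingFieldType F).
Hypothesis closedK : GRing.closed_field_axiom K.
Hypothesis char2 : 2%N \in [pchar K].
Implicit Type sigma : gal_of {:K}.

Lemma gal_expS sigma n (a : K) : (sigma ^+ n.+1)%g a = sigma ((sigma ^+ n)%g a).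
Proof. by rewrite expgSr galM ?memvf. Qed.

Lemma addrr2 (x : K) : x + x = 0.
Proof. by rewrite -mulr2n -mulr_natr (pcharf0 char2) mulr0. Qed.

(* If [u] has trace 1 and norm [a], and v^2 + v = a u, then the trace of v is fixed by
   [sigma] and is a root of x^2 + x = a, whose roots are u and u + 1. *)
Lemma no_involution sigma : (sigma ^+ 2 = 1)%g -> sigma = 1%g.
Proof.
move=> s2; apply/eqP; apply: contrapT => /negP/gal_eqP ns.
have [y ys] : exists y : K, sigma y != y.
  apply: contrapT => ny; apply: ns => y _; rewrite gal_id; apply/eqP.
  by apply: contrapT => /negP h; apply: ny; exists y.
have ss x : sigma (sigma x) = x.
  by have := gal_expS sigma 1 x; rewrite s2 expg1 gal_id.
have add_eq0 (x z : K) : (x + z == 0) = (x == z) by rewrite addr_eq0 (oppr_pchar2 char2).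
have t0 : y + sigma y != 0 by rewrite add_eq0 eq_sym.
pose u := y / (y + sigma y).
have uu : u + sigma u = 1.
  by rewrite /u rmorphM fmorphV rmorphD /= ss [sigma y + y]addrC -mulrDl divff.
pose a := u * sigma u.
have sa : sigma a = a by rewrite /a rmorphM /= ss mulrC.
have [v /eqP] : exists v : K, v ^+ 2 + v + a * u == 0.
  have [|v /rootP] := (@PreClosedField.closed_rootP _ closedK ('X^2 + 'X + (a * u)%:P)) _.
    by rewrite -addrA size_polyDl ?size_polyXn // size_XaddC.
  by rewrite !hornerE => e; exists v; rewrite expr2 e.
move=> /eqP; rewrite add_eq0 => /eqP ev.
have esv : sigma v ^+ 2 + sigma v = a * sigma u.
  by rewrite -{1}sa -rmorphM -ev rmorphD rmorphXn.
pose t := v + sigma v.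
have st : sigma t = t by rewrite /t rmorphD /= ss addrC.
have et : t ^+ 2 + t = a.
  transitivity ((v ^+ 2 + v) + (sigma v ^+ 2 + sigma v) + (v * sigma v + v * sigma v)).
    by rewrite /t; ring.
  by rewrite ev esv addrr2 addr0 -mulrDr uu mulr1.
clearbody t.
have eu : u ^+ 2 + u = a.
  transitivity (u * (u + sigma u) + (u + u) - u * sigma u - u); first by ring.
  by rewrite uu mulr1 addrr2 addr0 addrAC subrr sub0r (oppr_pchar2 char2).
have su : sigma u != u by rewrite -add_eq0 addrC uu oner_eq0.
have : (t + u) * (t + u + 1) == 0.
  apply/eqP; transitivity ((t ^+ 2 + t) + (u ^+ 2 + u) + (t * u + t * u)); first by ring.
  by rewrite et eu !addrr2.
rewrite mulf_eq0 -addrA !add_eq0 => /orP[] /eqP e.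
  by move: su; rewrite -e st eqxx.
have : sigma t != t.
  by rewrite e rmorphD rmorph1 /= (inj_eq (addIr _)).
by rewrite st eqxx.
Qed.

(* Kummer theory: [sigma] fixes a primitive q-th root of unity [z] and, by Hilbert 90,
   multiplies some alpha by [z].  Its q-th power multiplies a q-th root of alpha by
   [z * z ^+ (j * 'C(q, 2))], that is, by [z] as q is odd. *)
Lemma no_odd_order sigma q : prime q -> odd q -> (sigma ^+ q = 1)%g -> sigma = 1%g.
Proof.
move=> q_pr q_odd sq; have q0 := prime_gt0 q_pr; have q1 := prime_gt1 q_pr.
apply/eqP; apply: contrapT => /negP ns.
have ord_s : #[sigma]%g = q.
  apply/eqP; have := order_dvdn sigma q; rewrite sq eqxx => /idP.
  move/primeP: q_pr => [_ h] /h /orP[|//].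
  by rewrite order_eq1 (negPf ns).
have [z /rootP phi] : exists z : K, root (\poly_(i < q) 1) z.
  apply/(PreClosedField.closed_rootP closedK).
  by rewrite size_poly_eq ?oner_eq0 // neq_ltn q1 orbT.
have {}phi : \sum_(i < q) z ^+ i = 0.
  by move: phi; rewrite horner_poly; under eq_bigr => i _ do rewrite mul1r.
have zq : z ^+ q = 1.
  by apply/eqP; rewrite -subr_eq0 subrX1 phi mulr0.
have z1 : z != 1.
  apply/eqP => z1; move: phi; rewrite z1.
  under eq_bigr => i _ do rewrite expr1n.
  by move/eqP; rewrite sumr_const card_ord -(dvdn_pcharf char2) dvdn2 q_odd.
have prim : q.-primitive_root z.
  have [m pm mq] := prim_order_exists q0 zq.
  move/primeP: q_pr => [_ h]; have /orP[/eqP m1|/eqP <- //] := h _ mq.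
  by move: pm z1; rewrite m1 => /prim_expr_order; rewrite expr1 => ->; rewrite eqxx.
have z0 : z != 0 by apply: contraTneq (oner_neq0 K) => z0; rewrite -zq z0 expr0n gtn_eqF // eqxx.
(* If sigma z = z^k, then sigma^q = 1 gives k^q = 1 modulo q, while k^q = k by Fermat. *)
have sz : sigma z = z.
  have [[k kltq] /= ek] := prim_rootP prim
    (etrans (esym (rmorphXn sigma q z)) (etrans (congr1 sigma zq) (rmorph1 sigma))).
  have iter_s n : (sigma ^+ n)%g z = z ^+ (k ^ n).
    elim: n => [|n IH]; first by rewrite gal_id expr1.
    by rewrite gal_expS IH rmorphXn /= ek -exprM expnS.
  have := iter_s q; rewrite sq gal_id -{1}[z]expr1 => /eqP.
  rewrite (eq_prim_root_expr prim) => /eqP kq.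
  have ck : coprime k q.
    rewrite coprime_sym prime_coprime //; apply/negP => qk.
    move: kq; rewrite modn_small // => kq.
    have : (q %| k ^ q)%N by rewrite Euclid_dvdX // qk.
    by rewrite /dvdn -kq.
  have kt := Euler_exp_totient ck.
  rewrite totient_prime // in kt.
  have : (k ^ q = k %[mod q])%N.
    by rewrite -{1}(prednK q0) expnS -modnMmr kt modnMmr muln1.
  rewrite -kq => /esym e; rewrite ek; apply/eqP; rewrite -{2}[z]expr1.
  by rewrite (eq_prim_root_expr prim); apply/eqP.
have iter_z n : (sigma ^+ n)%g z = z.
  by elim: n => [|n IH]; rewrite ?gal_id // gal_expS IH.
have [alpha alpha0 salpha] : exists2 alpha : K, alpha != 0 & sigma alpha = z * alpha.
  have galE : 'Gal({:K} / fixedField <[sigma]>)%g = <[sigma]>%g by exact: gal_fixedField.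
  have gen : generator 'Gal({:K} / fixedField <[sigma]>)%g sigma by rewrite galE /generator.
  (* The norm of [z^-1] is its q-th power, as [sigma] fixes [z]. *)
  have /(Hilbert's_theorem_90 gen (memvf _))[b [_ b0] eb] :
      galNorm (fixedField <[sigma]>%g) {:K} z^-1 == 1.
    rewrite /galNorm galE (eq_bigr (fun=> z^-1)).
      by rewrite prodr_const -orderE ord_s exprVn zq invr1.
    by move=> x /cycleP[n ->]; rewrite fmorphV /= iter_z.
  exists b => //; apply: (mulfI (invr_neq0 z0)); rewrite mulKf // eb.
  by rewrite mulrVK // unitfE fmorph_eq0.
have [beta bq] := closed_root_exp alpha closedK q0.
have beta0 : beta != 0 by apply: contraNneq alpha0 => b0; rewrite -bq b0 expr0n gtn_eqF.
pose eta := sigma beta / beta.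
have etaq : eta ^+ q = z.
  by rewrite expr_div_n -rmorphXn /= bq salpha mulfK.
have eta0 : eta != 0 by rewrite mulf_neq0 ?invr_eq0 ?fmorph_eq0.
have sbeta : sigma beta = eta * beta by rewrite mulfVK.
have [j seta] : exists j : nat, sigma eta = z ^+ j * eta.
  have e : (sigma eta / eta) ^+ q = 1.
    by rewrite expr_div_n -rmorphXn /= etaq sz divff.
  have [j ej] := prim_rootP prim e.
  by exists j; rewrite -ej mulfVK.
have iter_b n : (sigma ^+ n)%g beta = z ^+ (j * 'C(n, 2)) * eta ^+ n * beta.
  elim: n => [|n IH]; first by rewrite gal_id muln0 !mul1r.
  rewrite gal_expS IH !rmorphM !rmorphXn /= sz seta sbeta exprMn binS bin1 -exprM.
  by rewrite mulnDr exprD exprSr; ring.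
have := iter_b q; rewrite sq gal_id etaq => /eqP.
rewrite -{1}[beta]mul1r (inj_eq (mulIf beta0)).
have /dvdnP[c ->] : (q %| j * 'C(q, 2))%N.
  rewrite dvdn_mull // prime_dvd_bin //= ltn_neqAle q1 andbT.
  by apply: contraTneq q_odd => <-.
by rewrite mulnC exprM zq expr1n mul1r eq_sym (negPf z1).
Qed.

End ArtinSchreier.

Lemma closed_monic_split (K : fieldType) : GRing.closed_field_axiom K ->
  forall p : {poly K}, p \is monic -> exists r, p = \prod_(z <- r) ('X - z%:P).
Proof.
move=> closedK p; elim: (size p) {-2}p (leqnn (size p)) => [|n IH] {}p pn pm.
  by rewrite size_poly_leq0 in pn; rewrite (eqP pn) monicE lead_coef0 eq_sym oner_eq0 in pm.
have [p1|p1] := eqVneq (size p) 1%N.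
  exists [::]; rewrite big_nil; move: pm; rewrite monicE (size1_polyC (eq_leq p1)).
  by rewrite lead_coefC => /eqP ->.
have [z /factor_theorem[q pq]] := PreClosedField.closed_rootP closedK p p1.
have qm : q \is monic by move: pm; rewrite pq monicMr ?monicXsubC.
have [|r er] := IH q _ qm; last by exists (z :: r); rewrite pq er big_cons mulrC.
by move: pn; rewrite pq size_Mmonic ?monic_neq0 ?monicXsubC // size_XsubC addn2.
Qed.

Section Char2.
Variables (F : fieldType) (K : fieldExtType F).
Hypothesis closedK : GRing.closed_field_axiom K.
Hypothesis char2 : 2%N \in [pchar F].

Let char2K : 2%N \in [pchar K]. Proof. by rewrite pchar_lalg. Qed.

Lemma pchar2_sum_sqr (R : fieldType) (I : finType) (f : I -> R) :
  2%N \in [pchar R] -> (\sum_i f i) ^+ 2 = \sum_i f i ^+ 2.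
Proof. by move=> c2; exact: (rmorph_sum (pFrobenius_aut c2)). Qed.

(* The squares of a basis of [K] over [F] span [K], hence form a basis. *)
Lemma base_perfect (a : F) : exists b, b ^+ 2 = a.
Proof.
pose n := \dim {:K}; pose e := vbasis {:K}.
pose e2 := [tuple e`_i ^+ 2 | i < n].
have coordK (z : K) : z = \sum_(i < n) coord e i z *: e`_i.
  by apply: coord_vbasis; exact: memvf.
have span2 (z : K) : exists c : 'I_n -> F, z ^+ 2 = \sum_(i < n) c i ^+ 2 *: e`_i ^+ 2.
  exists (fun i => coord e i z); rewrite {1}(coordK z) pchar2_sum_sqr //.
  by apply: eq_bigr => i _; rewrite exprZn.
have e2E (i : 'I_n) : e2`_i = e`_i ^+ 2 by rewrite -tnth_nth tnth_mktuple.
have free2 : free e2.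
  apply: (@basis_free _ _ {:K}); rewrite basisEdim size_tuple leqnn andbT.
  apply/subvP => y _; have [z <-] := closed_root_exp y closedK (isT : (0 < 2)%N).
  have [c ->] := span2 z; apply: memv_suml => i _.
  by rewrite -e2E memvZ // memv_span // mem_nth // size_tuple.
have n0 : (0 < n)%N by rewrite adim_gt0.
pose i0 := Ordinal n0.
have [z ez] := closed_root_exp (a *: e`_i0 ^+ 2) closedK (isT : (0 < 2)%N).
have [c ec] := span2 z; exists (c i0).
have := coord_sum_free (fun i => c i ^+ 2) i0 free2.
rewrite (eq_bigr (fun i => c i ^+ 2 *: e`_i ^+ 2)) => [<-|i _]; last by rewrite e2E.
have e1 := coord_free i0 i0 free2; rewrite eqxx in e1.
rewrite -ec ez -e2E; transitivity (a * coord e2 i0 e2`_i0); first exact: linearZ.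
by rewrite e1 mulr1.
Qed.

(** In characteristic 2 separability means that [x] lies in F(x^2). Square roots of the coefficients
    of the minimal polynomial of x^2 give a polynomial of no larger degree vanishing at [x], so F(x)
    and F(x^2) have equal dimension. *)
Lemma pchar2_separable (x : K) : separable_element 1 x.
Proof.
rewrite (pcharf_p_separable _ _ 0 char2K) expn1.
have sub : (<<1; x ^+ 2>> <= <<1; x>>)%VS.
  by apply/FadjoinP; split; [exact: subv_adjoin | rewrite rpredX // memv_adjoin].
suff /eqP -> : <<1; x ^+ 2>>%VS == <<1; x>>%VS by exact: memv_adjoin.
rewrite eqEdim sub /= !dim_Fadjoin dimv1 !muln1 -ltnS -!size_minPoly.
have /polyOver1P[p ep] := minPolyOver 1 (x ^+ 2).
have /choice[s sE] := base_perfect.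
pose h := \poly_(i < size p) s p`_i.
have p0 : p != 0.
  by rewrite -(map_poly_eq0 (in_alg K)) -ep monic_neq0 // monic_minPoly.
have h0 : h != 0.
  apply: contraNneq (p0) => h0; rewrite -lead_coef_eq0 -[lead_coef p]sE.
  have : h`_(size p).-1 = 0 by rewrite h0 coef0.
  by rewrite coef_poly ltn_predL size_poly_gt0 p0 -lead_coefE => ->; rewrite expr0n.
have hx : root (map_poly (in_alg K) h) x.
  have szh : (size (map_poly (in_alg K) h) <= size p)%N by rewrite size_map_poly size_poly.
  rewrite rootE; suff : (map_poly (in_alg K) h).[x] ^+ 2 == 0 by rewrite expf_eq0.
  rewrite (horner_coef_wide _ szh) pchar2_sum_sqr //.
  have := minPolyxx 1 (x ^+ 2); rewrite ep horner_coef size_map_poly => e.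
  apply/eqP; rewrite -[RHS]e; apply: eq_bigr => i _.
  by rewrite exprMn -!exprM mulnC !coef_map coef_poly ltn_ord -rmorphXn /= sE.
have h0' : map_poly (in_alg K) h != 0 by rewrite map_poly_eq0.
have : minPoly 1 x %| map_poly (in_alg K) h.
  by apply: minPoly_dvdp => //; apply/polyOver1P; exists h.
move=> /(dvdp_leq h0') /leq_trans; apply; rewrite ep !size_map_poly; exact: size_poly.
Qed.

Lemma pchar2_dim1 : \dim {:K} = 1%N.
Proof.
have split : splitting_field_axiom K.
  apply: normal_field_splitting => E x.
  by have [r ->] := closed_monic_split closedK (monic_minPoly E x); exists r.
pose K' : splittingFieldType F := HB.pack K (FieldExt_isSplittingField.Build F K split).
have gal : galois 1 {:K'}.
  apply/and3P; split; first exact: sub1v.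
    by apply/separableP => y _; exact: pchar2_separable.
  exact: normalFieldf.
have dimG := galois_dim gal.
rewrite dimv1 divn1 in dimG.
apply: contrapT => /eqP n1; have n1' : (1 < #|'Gal({:K'} / 1)%g|)%N.
  by rewrite -dimG ltn_neqAle eq_sym n1 adim_gt0.
have qpr := pdiv_prime n1'; have [s _ os] := Cauchy qpr (pdiv_dvd _).
have s1 : s = 1%g.
  have sq : (s ^+ pdiv #|'Gal({:K'} / 1)%g|)%g = 1%g by rewrite -os expg_order.
  have [q2|qodd] := even_prime qpr; first by rewrite q2 in sq; exact: (@no_involution _ K').
  exact: (@no_odd_order _ K' closedK char2K _ _ qpr).
by move: qpr; rewrite -os s1 order1.
Qed.

End Char2.

Lemma closed_irreducible_size (F : fieldType) (q : {poly F}) :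
  GRing.closed_field_axiom F -> irreducible_poly q -> (size q <= 2)%N.
Proof.
move=> closedF [q1 qirr].
have /(PreClosedField.closed_rootP closedF)[z rz] : size q != 1%N by rewrite neq_ltn q1 orbT.
have : 'X - z%:P %= q by apply: qirr; rewrite ?size_XsubC // dvdp_XsubCl.
move/eqp_size => sz; have {}sz : size ('X - z%:P) = size q by exact: sz.
by rewrite -sz size_XsubC.
Qed.

(** [q] is associate to the minimal polynomial of a root in [K], whose degree is at most [K : F]. *)
Lemma finite_closure_irreducible_size (F : fieldType) (K : fieldExtType F) (q : {poly F}) :
  GRing.closed_field_axiom K -> irreducible_poly q -> (size q <= (\dim {:K}).+1)%N.
Proof.
move=> closedK [q1 qirr].
have /(PreClosedField.closed_rootP closedK)[z rz] : size (map_poly (in_alg K) q) != 1%N.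
  by rewrite size_map_poly neq_ltn q1 orbT.
have /polyOver1P[p ep] := minPolyOver 1 z.
have pq : p %| q.
  rewrite -(dvdp_map (in_alg K)) -ep minPoly_dvdp //.
  by apply/polyOver1P; exists q.
have szp : size p = size (minPoly 1 z) by rewrite ep size_map_poly.
have : p %= q by apply: qirr => //; rewrite szp size_minPoly.
move/eqp_size => sz; have {}sz : size p = size q by exact: sz.
rewrite -sz szp size_minPoly ltnS.
have := dim_Fadjoin 1 z; rewrite dimv1 muln1 => <-.
exact: dimvS (subvf _).
Qed.

(** * The ring D *)

Section Levels.
Variables (F L : fieldType) (iota : {rmorphism F -> L}) (X : dyadic_roots iota).
Local Notation D := (dyadicLaurent X).

Lemma rootX_exp n k : X (k + n)%N ^+ (2 ^ k) = X n.
Proof. by elim: k => [|k IH]; rewrite ?expr1 // addSn expnS exprM dyadic_root_sqr. Qed.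

Lemma rootX_transcendental n : ~ algebraicOver iota (X n).
Proof.
move=> alg; apply: (@dyadic_root_transcendental _ _ _ X).
rewrite -[X 0%N](rootX_exp 0 n) addn0; elim: (2 ^ n)%N => [|k IH].
  by rewrite expr0 -(rmorph1 iota); exact: algebraic_id.
by rewrite exprS; apply: algebraic_mul.
Qed.

Lemma rootX_neq0 n : X n != 0.
Proof.
by apply/eqP => X0; apply: (@rootX_transcendental n); rewrite X0 -(rmorph0 iota); exact: algebraic_id.
Qed.

Lemma laurent_dyadic n z : laurent X n z -> z \in dyadic_laurent X.
Proof. by move=> Lz; apply/asboolP; exists n. Qed.

Lemma laurent_gen n : range iota `|` [set X n; (X n)^-1] `<=` laurent X n.
Proof. exact: sub_smallest. Qed.

Lemma rootX_mem n : X n \in dyadic_laurent X.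
Proof. by apply: (@laurent_dyadic n); apply: laurent_gen; right; left. Qed.

Lemma rootXV_mem n : (X n)^-1 \in dyadic_laurent X.
Proof. by apply: (@laurent_dyadic n); apply: laurent_gen; right; right. Qed.

Lemma eval_mem n (p : {poly F}) : (map_poly iota p).[X n] \in dyadic_laurent X.
Proof.
elim/poly_ind: p => [|p c IH]; first by rewrite rmorph0 horner0 rpred0.
rewrite rmorphD rmorphM /= map_polyX map_polyC hornerMXaddC /=.
rewrite rpredD ?rpredM ?rootX_mem //.
by apply: (@laurent_dyadic 0); apply: laurent_gen; left; exists c.
Qed.

Definition emb n (p : {poly F}) : D := exist (fun z : L => z \in dyadic_laurent X) _ (eval_mem n p).

Lemma emb_is_zmod_morphism n : zmod_morphism (emb n).
Proof. by move=> p q; apply: val_inj; rewrite /= rmorphB hornerD hornerN. Qed.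

Lemma emb_is_monoid_morphism n : monoid_morphism (emb n).
Proof.
by split=> [|p q]; apply: val_inj; rewrite /= ?rmorph1 ?hornerE // rmorphM hornerM.
Qed.

HB.instance Definition _ n := GRing.isZmodMorphism.Build {poly F} D (emb n) (emb_is_zmod_morphism n).
HB.instance Definition _ n := GRing.isMonoidMorphism.Build {poly F} D (emb n) (emb_is_monoid_morphism n).

Lemma emb_eq0 n p : (emb n p == 0) = (p == 0).
Proof.
apply/eqP/eqP => [|->]; last exact: rmorph0.
move=> /(congr1 val) /= p0; apply: contrapT => /eqP pn0.
by apply: (@rootX_transcendental n); exists p => //; apply/rootP.
Qed.

Lemma emb_inj n : injective (emb n).
Proof. by move=> p q /eqP; rewrite -subr_eq0 -rmorphB emb_eq0 subr_eq0 => /eqP. Qed.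

Lemma emb_dilate k n p : emb (k + n) (dilate k p) = emb n p.
Proof.
apply: val_inj; rewrite /= /dilate map_comp_poly map_polyXn horner_comp hornerXn.
by rewrite rootX_exp.
Qed.

Lemma embX_unit n : emb n 'X \is a GRing.unit.
Proof.
apply/unitrPr; exists (exist (fun z : L => z \in dyadic_laurent X) _ (rootXV_mem n)); apply: val_inj.
by rewrite /= map_polyX hornerX divff // rootX_neq0.
Qed.

Lemma emb_const_unit n (c : F) : c != 0 -> emb n c%:P \is a GRing.unit.
Proof.
by move=> c0; apply/unitrPr; exists (emb n c^-1%:P); rewrite -rmorphM -polyCM divff // rmorph1.
Qed.

Lemma laurent_repr n z : laurent X n z ->
  exists j p, z * X n ^+ j = (map_poly iota p).[X n].
Proof.
pose S : set L := [set z | exists j p, z * X n ^+ j = (map_poly iota p).[X n]].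
apply: (_ : laurent X n `<=` S); apply: smallest_sub.
  split.
  - by apply/mem_set; exists 0%N, 1; rewrite mulr1 rmorph1 hornerC.
  - move=> x y /set_mem[j [p ep]] /set_mem[k [q eq]]; apply/mem_set.
    exists (j + k)%N, (p * 'X^k - q * 'X^j).
    rewrite rmorphB !rmorphM /= !map_polyXn hornerD hornerN !hornerM !hornerXn -ep -eq exprD.
    by ring.
  - move=> x y /set_mem[j [p ep]] /set_mem[k [q eq]]; apply/mem_set.
    by exists (j + k)%N, (p * q); rewrite rmorphM hornerM -ep -eq exprD; ring.
move=> _ [[c _ <-]|[->|->]].
- by exists 0%N, c%:P; rewrite mulr1 map_polyC hornerC.
- by exists 0%N, 'X; rewrite mulr1 map_polyX hornerX.
- by exists 1%N, 1; rewrite expr1 mulVf ?rootX_neq0 // rmorph1 hornerC.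
Qed.

Lemma emb_repr (x : D) : exists n0, forall m, (n0 <= m)%N ->
  exists j p, x * emb m 'X ^+ j = emb m p.
Proof.
have /asboolP[n _ /laurent_repr[j [p ep]]] := valP x.
exists n => m /subnK <-; set k := (m - n)%N.
have e : x * emb n 'X ^+ j = emb n p.
  by apply: val_inj; rewrite rmorphM rmorphXn /= -ep map_polyX hornerX.
exists (2 ^ k * j)%N, (dilate k p); rewrite emb_dilate -e exprM -[emb n 'X](emb_dilate k).
by rewrite /dilate comp_polyX rmorphXn.
Qed.

(** Holding at all high levels, this puts several elements at a common level. Powers of X are moved
    into the unit, which leaves a polynomial prime to X. *)
Lemma emb_unit_repr (x : D) : exists n0, forall m, (n0 <= m)%N ->
  exists u p, [/\ u \is a GRing.unit, x = u * emb m p & x != 0 -> ~~ root p 0].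
Proof.
have [n0 Hn0] := emb_repr x; exists n0 => m /Hn0[j [p e]].
have [->|x0] := eqVneq x 0; first by exists 1, 0; rewrite rmorph0 mulr0 unitr1; split.
have Xj : emb m 'X ^+ j \is a GRing.unit by rewrite unitrX // embX_unit.
have p0 : p != 0.
  rewrite -(emb_eq0 m) -e mulf_neq0 //; apply/eqP => h; move: Xj; rewrite h unitr0 //.
have [i [q q0 eq]] := multiplicity_XsubC p 0.
rewrite p0 /= in q0; rewrite subr0 in eq.
exists (emb m 'X ^+ i / emb m 'X ^+ j), q; split=> //.
  by rewrite unitrM unitrV Xj andbT unitrX // embX_unit.
apply: (mulIr Xj); rewrite e eq rmorphM rmorphXn /= mulrAC mulrVK //.
by rewrite mulrC.
Qed.

Lemma dvd_emb n p q : dvdp p q -> dvd (emb n p) (emb n q).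
Proof. by move=> /dvdpP[t ->]; exists (emb n t); rewrite rmorphM. Qed.

(** The cofactor may live at a higher level, hence the dilation; its power of X is cancelled by
    coprimality. *)
Lemma emb_dvd n p q : ~~ root p 0 -> dvd (emb n p) (emb n q) ->
  exists k, dvdp (dilate k p) (dilate k q).
Proof.
move=> p0 [c ec]; have [n0 Hn0] := emb_repr c.
have [j [r er]] := Hn0 (n0 + n)%N (leq_addr _ _).
exists n0; have : dilate n0 q * 'X^j = r * dilate n0 p.
  apply: (@emb_inj (n0 + n)); rewrite !rmorphM rmorphXn /= -er !emb_dilate ec; ring.
move=> e; rewrite -(@Gauss_dvdpl _ _ 'X^j); first by rewrite e dvdp_mull.
by rewrite coprimep_expr // coprimepX dilate_root0.
Qed.

Lemma dvd_unitl (R : idomainType) (u a b : R) : u \is a GRing.unit -> dvd (u * a) b <-> dvd a b.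
Proof.
move=> uu; split=> [[c ->]|[c ->]]; first by exists (c * u); rewrite mulrA.
by exists (c / u); rewrite mulrA mulrVK.
Qed.

Lemma dvd_unitr (R : idomainType) (u a b : R) : u \is a GRing.unit -> dvd a (u * b) <-> dvd a b.
Proof.
move=> uu; split=> [[c e]|]; last exact: dvd_mull.
by exists (u^-1 * c); rewrite -mulrA -e mulKr.
Qed.

Lemma emb_nonunit n p : ~~ root p 0 -> (1 < size p)%N -> emb n p \isn't a GRing.unit.
Proof.
move=> p0 p1; apply/negP => up.
have [|k] := @emb_dvd n p 1 p0; first by exists (emb n p)^-1; rewrite mulVr // rmorph1.
rewrite {2}/dilate comp_polyC dvdp1 => /eqP sz; have := size_dilate k p.
rewrite sz; have := expn_gt0 2 k; move: p1.
by move: (size p) (2 ^ k)%N => a b; nia.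
Qed.

Lemma emb_nonunit_size n p u : u * emb n p \isn't a GRing.unit -> u \is a GRing.unit -> p != 0 ->
  (1 < size p)%N.
Proof.
move=> nu uu p0; rewrite ltnNge; apply/negP => p1.
have [c c0 pc] : exists2 c, c != 0 & p = c%:P.
  by exists p`_0; [|exact: size1_polyC]; apply: contraNneq p0 => c0; rewrite (size1_polyC p1) c0.
by move/negP: nu; apply; rewrite unitrM uu pc emb_const_unit.
Qed.

Lemma dyadic_nontrivial : exists2 a : D, a != 0 & a \isn't a GRing.unit.
Proof.
exists (emb 0 ('X - 1)).
  by rewrite emb_eq0 -size_poly_eq0 -[1]/(1%:P) size_XsubC.
apply: emb_nonunit; last by rewrite -[1]/(1%:P) size_XsubC.
by rewrite -[1]/(1%:P) root_XsubC eq_sym oner_eq0.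
Qed.

Lemma dyadic_bezout (x y : D) : exists d u v, [/\ dvd d x, dvd d y & d = u * x + v * y].
Proof.
have [n Hn] := emb_unit_repr x; have [m Hm] := emb_unit_repr y.
have [u [p [uu ex _]]] := Hn (maxn n m) (leq_maxl _ _).
have [v [q [uv ey _]]] := Hm (maxn n m) (leq_maxr _ _).
have [[a b] /= ab] := Bezoutp p q; set l := maxn n m in ex ey.
exists (emb l (a * p + b * q)), (emb l a / u), (emb l b / v); split.
- rewrite ex; apply/dvd_unitr => //; apply: dvd_emb.
  by rewrite (eqp_dvdl _ ab) dvdp_gcdl.
- rewrite ey; apply/dvd_unitr => //; apply: dvd_emb.
  by rewrite (eqp_dvdl _ ab) dvdp_gcdr.
- by rewrite rmorphD !rmorphM ex ey !mulrA !mulrVK.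
Qed.

Hypothesis char2 : 2%N \notin [pchar F].

Lemma emb_radical n r : ~~ root r 0 -> radical_poly r -> radical_elt (emb n r).
Proof.
move=> r0 rr s k; have [m Hm] := emb_unit_repr s.
have [u [q [uu es _]]] := Hm (m + n)%N (leq_addr _ _).
rewrite es exprMn -rmorphXn -(emb_dilate m n r) => /dvd_unitr h.
have [|l] := @emb_dvd _ (dilate m r) (q ^+ k) _ (h (unitrX _ uu)); first by rewrite dilate_root0.
rewrite dilate_add [dilate l (q ^+ k)]rmorphXn /= => /(dilate_radical char2 r0 rr) H.
apply/dvd_unitr => //.
rewrite -(emb_dilate l) -[emb _ q](emb_dilate l); apply: dvd_emb.
by rewrite dilate_add.
Qed.

Lemma dyadic_radical (f : D) : f != 0 -> exists r k,
  [/\ radical_elt r, dvd r f & dvd f (r ^+ k)].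
Proof.
move=> f0; have [n Hn] := emb_unit_repr f; have [u [p [uu ef p0]]] := Hn n (leqnn n).
have {}p0 := p0 f0; have pn0 : p != 0 by apply: contraNneq p0 => ->; exact: root0.
have [r [k [rr rp pr]]] := radical_poly_exists pn0.
have r0 : ~~ root r 0.
  by apply: contra p0; have /dvdpP[t ->] := rp => r0; rewrite rootM r0 orbT.
exists (emb n r), k; split; first exact: emb_radical.
  by rewrite ef; apply/dvd_unitr => //; exact: dvd_emb.
by rewrite ef; apply/dvd_unitl => //; rewrite -rmorphXn; exact: dvd_emb.
Qed.

Lemma dyadic_splitting N : (forall q : {poly F}, irreducible_poly q -> (size q <= N)%N) ->
  forall a : D, a != 0 -> a \isn't a GRing.unit ->
  exists b c, [/\ b \isn't a GRing.unit, c \isn't a GRing.unit, dvd b a, dvd c a &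
    comaximal b c].
Proof.
move=> HN a a0 au; have [n Hn] := emb_unit_repr a; have [u [p [uu ea p0]]] := Hn n (leqnn n).
have {}p0 := p0 a0; have pn0 : p != 0 by apply: contraNneq p0 => ->; exact: root0.
have p1 : (1 < size p)%N by apply: (@emb_nonunit_size n p u) => //; rewrite -ea.
have [k [s [t [s1 t1 sp tp cst]]]] := dilate_splits char2 HN p1 p0.
have l0 : ~~ root (dilate k p) 0 by rewrite dilate_root0.
have s0 : ~~ root s 0 by apply: contra l0; have /dvdpP[r ->] := sp => h; rewrite rootM h orbT.
have t0 : ~~ root t 0 by apply: contra l0; have /dvdpP[r ->] := tp => h; rewrite rootM h orbT.
exists (emb (k + n) s), (emb (k + n) t); split.
- exact: emb_nonunit.
- exact: emb_nonunit.
- by rewrite ea -(emb_dilate k n p); apply/dvd_unitr => //; exact: dvd_emb.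
- by rewrite ea -(emb_dilate k n p); apply/dvd_unitr => //; exact: dvd_emb.
have /Bezout_eq1_coprimepP[[v w] /= vw] := cst.
by exists (emb (k + n) v), (emb (k + n) w); rewrite -!rmorphM -rmorphD vw rmorph1.
Qed.

(** At each level the polynomial of [a] has finitely many divisors up to associates, and a gcd of
    [x] and [a] is one of them at a level where [x] lives. [E] enumerates the pairs of a level and
    an index. *)
Lemma dyadic_countable_divisors (a : D) : a != 0 ->
  exists E : nat -> D, forall x, exists n u v, E n = u * x + v * a /\ dvd (E n) x.
Proof.
move=> a0; have [n Hn] := emb_unit_repr a; have [u [p [uu ea p0]]] := Hn n (leqnn n).
have {}p0 := p0 a0; have pn0 : p != 0 by apply: contraNneq p0 => ->; exact: root0.
have /choice[s sP] : forall k, exists s : seq {poly F}, forall d, dvdp d (dilate k p) ->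
    exists2 e, e \in s & eqp d e.
  by move=> k; apply: finite_divisors; rewrite dilate_eq0.
pose E (c : nat) : D := if (unpickle c : option (nat * nat)) is Some (k, i)
  then emb (k + n) (nth 0 (s k) i) else 0.
exists E => x; have [m Hm] := emb_unit_repr x.
have [v [q [uv ex _]]] := Hm (m + n)%N (leq_addr _ _).
have [e es ge] := sP m (gcdp q (dilate m p)) (dvdp_gcdr _ _).
exists (pickle (m, index e (s m))).
have [[b c] /= bc] := Bezoutp q (dilate m p).
have /eqpP[[y z] /andP[/= y0 z0] yz] := eqp_trans bc ge.
have -> : E (pickle (m, index e (s m))) = emb (m + n) e by rewrite /E pickleK nth_index.
have ee : e = (z^-1 * y)%:P * (b * q + c * dilate m p).
  by rewrite mul_polyC -scalerA yz scalerA mulVf // scale1r.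
exists (emb (m + n) ((z^-1 * y)%:P * b) / v), (emb (m + n) ((z^-1 * y)%:P * c) / u); split.
  rewrite ex ea -(emb_dilate m n p) !mulrA !mulrVK // -!rmorphM -rmorphD; congr emb.
  by rewrite {1}ee; ring.
rewrite ex; apply/dvd_unitr => //; apply: dvd_emb.
by rewrite -(eqp_dvdl _ ge) dvdp_gcdl.
Qed.

End Levels.

(** * Cardinality bounds and conclusion *)

Lemma card_le_exists_inj (T U : Type) :
  [set: T] #<= [set: U] -> exists f : T -> U, injective f.
Proof.
move=> /card_leP[f]; exists (fun x => \val (f (to_setT x))) => x y /val_inj e.
have /(congr1 val) // : to_setT x = to_setT y by apply: (@inj _ _ _ f); rewrite ?in_setT.
Qed.

Lemma countable_poly (F : fieldType) : countable [set: F] -> countable [set: {poly F}].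
Proof.
move=> /card_le_exists_inj[f finj].
apply: (@card_le_inj _ _ (fun p : {poly F} => pickle (map f p))) => // p q.
by move=> /(pcan_inj pickleK) /(inj_map finj) /val_inj.
Qed.

Lemma countable_dyadicLaurent (F L : fieldType) (iota : {rmorphism F -> L})
  (X : dyadic_roots iota) : countable [set: F] -> countable [set: dyadicLaurent X].
Proof.
move=> /countable_poly /card_le_exists_inj[c cinj].
pose f (t : nat * nat * {poly F}) : dyadicLaurent X := emb X t.1.1 t.2 / emb X t.1.1 'X ^+ t.1.2.
apply: (@card_le_trans _ _ _ [set: nat * nat * {poly F}]).
  apply: (@card_le_trans _ _ _ (f @` setT)); last exact: card_image_le.
  apply: subset_card_le => x _; have [n /(_ n (leqnn n))[j [p e]]] := emb_repr x.
  exists (n, j, p) => //; rewrite /f /= -e mulrK // unitrX //; exact: embX_unit.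
apply: (@card_le_inj _ _ (fun t => pickle (t.1, c t.2))) => // -[s p] [t q] /=.
by move=> /(pcan_inj pickleK) [-> /cinj ->].
Qed.

Lemma card_powerSeries (R : comNzRingType) :
  countable [set: R] -> [set: powerSeries R] #<= [set: set nat].
Proof.
move=> /card_le_exists_inj[c cinj].
apply: (@card_le_inj _ _ (fun f : powerSeries R => [set pickle (i, c (f i)) | i in [set: nat]])) => //.
move=> f g e; apply/funext => i.
have : [set pickle (i, c (g i)) | i in [set: nat]] (pickle (i, c (f i))) by rewrite -e; exists i.
by move=> [j _ /(pcan_inj pickleK)[-> /cinj]].
Qed.

(** A ring of cardinality at most T has at most 2^T subsets, so no set of ideals is larger than
    2^T. *)
Lemma dim_eq_of_card (R : comNzRingType) (T : Type) :
  [set: R] #<= [set: T] -> dim_ge R (set T) -> dim_eq R (set T).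
Proof.
move=> /card_le_exists_inj[f finj] [C hC TC].
have bound (B : set (set R)) : length_le B (set T).
  apply: (@card_le_trans _ _ _ [set: set R]); first exact: card_leT.
  apply: (@card_le_inj _ _ (fun A : set R => Some (f @` A))) => // A B' [e].
  apply/seteqP; split=> x Ax.
    by have : (f @` A) (f x) by [exists x]; rewrite e => -[y By /finj <-].
  by have : (f @` B') (f x) by [exists x]; rewrite -e => -[y By /finj <-].
split; last by move=> B _; exact: bound.
by exists C => //; apply: Cantor_Bernstein => //; exact: bound.
Qed.

Theorem corollary4p4 (F : fieldType)
    (hF : (GRing.closed_field_axiom F /\ 2%N \notin [pchar F]) \/ real_closed F)
    (L : fieldType) (iota : {rmorphism F -> L}) (X : dyadic_roots iota) :
  let D : idomainType := dyadicLaurent X in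
  (* (1) *) (SP_domain D /\ ~ Dedekind_domain D) /\
  (* (2) *) (~ exists p : D, irreducible p) /\
  (* (3) *) (forall M : set D, maximal_ideal M -> ~ invertible M) /\
  (* (4) *) (forall a : D, a != 0 -> a \isn't a GRing.unit ->
    [set M : set D | maximal_ideal M /\ M a] #= [set: set nat]) /\
  (* (5) *) ((forall (M : set D) (hM : maximal_ideal M),
      ht_ge (series_quot_prime (maximal_prime hM)) (set aleph1)) /\
    dim_ge (powerSeries D) (set aleph1) /\
    (continuum_hypothesis -> countable [set: F] ->
      dim_eq (powerSeries D) (set aleph1))).
Proof.
move=> D.
have [char2 [N irrN]] : 2%N \notin [pchar F] /\
    exists N, forall q : {poly F}, irreducible_poly q -> (size q <= N)%N.
  case: hF => [[closedF char2]|[K [[closedK _] dimK]]].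
    by split=> //; exists 2%N => q; exact: closed_irreducible_size.
  split; last by exists (\dim {:K}).+1 => q; exact: finite_closure_irreducible_size.
  by apply/negP => char2; rewrite (pchar2_dim1 closedK char2) in dimK.
have nontriv := dyadic_nontrivial X.
have bez := @dyadic_bezout _ _ _ X.
have rad := @dyadic_radical _ _ _ X char2.
have spl := @dyadic_splitting _ _ _ X char2 N irrN.
have cdiv := @dyadic_countable_divisors _ _ _ X.
have series M (hM : maximal_ideal M) : exists Q : set (option aleph1) -> set (powerSeries D),
    [/\ forall x, prime_ideal (Q x), injective Q,
      forall x y, Q x `<=` Q y \/ Q y `<=` Q x,
      forall x, extended_ideal M `<=` Q x & forall x, Q x `<=` series_ideal M].
  have [P [p [Pprime Pp MP]]] := maximal_separating_family nontriv bez rad spl cdiv hM.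
  exact: prime_family hM Pprime Pp MP.
have dimge : dim_ge (powerSeries D) (set aleph1).
  have [a a0 au] := nontriv.
  have [|M hM _] := @exists_maximal_ideal D (dvd a).
    by split; [exact: principal_ideal | move/dvd1_unit; apply/negP].
  by have [Q [Qprime Qinj Qtot _ _]] := series M hM; exact: dim_ge_family Qprime Qinj Qtot.
split; [split; [exact: SP_domain_of_bezout | exact: not_Dedekind]|split].
  exact: no_irreducible.
split; first by move=> M /maximal_prime; exact: prime_not_invertible.
split; first by move=> a; exact: card_maximal_ideals.
split; last split=> //.
  move=> M hM; have [Q [Qprime Qinj Qtot MQ QM]] := series M hM.
  exact: (ht_ge_series_quot (maximal_prime hM) Qprime Qinj Qtot MQ QM).
move=> ch cF; apply: dim_eq_of_card dimge.
(* A countable [F] gives a countable D, so D[[Y]] has at most 2^aleph_0 elements, which is aleph_1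
   under the continuum hypothesis. *)
apply: card_le_trans (card_powerSeries (countable_dyadicLaurent X cF)) _.
by rewrite -(card_le_eqr ch).
Qed.
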